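(* Let $W$ be of type $A_{n-1}$, $B_n$ or $D_n$, with set of reflections $T$, and choose a Coxeter element $\gamma$ and a total ordering $<$ of $T$ as follows. Type $A_{n-1}$: $W$ is the symmetric group on $\{1,\dots,n\}$, $T$ is the set of transpositions $(i,j)$, $1\le i<j\le n$, $\gamma=(1,2,\dots,n)$, and $<$ is any total ordering of $T$ such that $(i,j)<(i,k)<(j,k)$ for all $1\le i<j<k\le n$. Type $B_n$: $\gamma=[1,2,\dots,n]$, $T$ consists of $(\!(i,j)\!)$ and $(\!(i,-j)\!)$ for $1\le i<j\le n$ and $[i]$ for $1\le i\le n$, and $<$ is any total ordering of $T$ such that - $(\!(i,j)\!)<(\!(i,k)\!)<(\!(j,k)\!)$ for $1\le i<j<k\le n$; - $(\!(i,j)\!)<(\!(i,-k)\!)<(\!(j,-k)\!)$ for $1\le i<j\le n$ and ($1\le k<i$ or $j<k\le n$); - $(\!(i,j)\!)<[i]<(\!(i,-j)\!)<[j]$ for $1\le i<j\le n$. Type $D_n$: $\gamma=[1,2,\dots,n-1]\,[n]$, $T$ consists of $(\!(i,j)\!)$ and $(\!(i,-j)\!)$ for $1\le i<j\le n$, and $<$ is any total ordering of $T$ such that - $(\!(i,j)\!)<(\!(i,k)\!)<(\!(j,k)\!)$ for $1\le i<j<k\le n$; - $(\!(i,j)\!)<(\!(i,-k)\!)<(\!(j,-k)\!)$ for $1\le i<j\le n-1$ and ($1\le k<i$ or $j<k\le n$); - $(\!(i,\pm n)\!)<(\!(i,-j)\!)<(\!(j,\pm n)\!)$ for $1\le i<j\le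 n-1$ (for all choices of signs). Then the natural edge labeling of $\mathrm{NC}_W(\gamma)$, with label set $T$ totally ordered by $<$, is an EL-labeling.
   Context: Elements of the reflection groups of types $B_n$ and $D_n$ are represented as permutations of $\{1,\dots,n,-1,\dots,-n\}$ commuting with negation: $(\!(i_1,\dots,i_k)\!)$ is the product of cycles $(i_1,\dots,i_k)(-i_1,\dots,-i_k)$, and $[i_1,\dots,i_k]$ is the balanced cycle $(i_1,\dots,i_k,-i_1,\dots,-i_k)$. Thus $(\!(j,-k)\!)=(\!(k,-j)\!)$ and $[i]=(i,-i)$. Type $B_n$ is the group of all such signed permutations, and type $D_n$ is its subgroup generated by all $(\!(i,j)\!)$ and $(\!(i,-j)\!)$. Positive roots are $e_i-e_j$ ($i<j$) for $A_{n-1}$; $e_i$ and $e_i\pm e_j$ ($i<j$) for $B_n$; $e_i\pm e_j$ ($i<j$) for $D_n$; the reflections in $e_i-e_j$, $e_i+e_j$, $e_i$ are $(i,j)$ (type $A$) or $(\!(i,j)\!)$ (types $B,D$), $(\!(i,-j)\!)$, and $[i]$ respectively. Products of permutations are compositions of maps, the rightmost factor being applied first. As usual $n\ge 2$ in types $A_{n-1}$ and $B_n$, and $n\ge4$ in type $D_n$. For $w\in W$, $l_T(w)$ is the smallest $k$ such that $w$ is a product of $k$ elements of $T$; $u\preceq v$ if and only if $l_T(u)+l_T(u^{-1}v)=l_T(v)$; $\mathrm{NC}_W(w)$ is the interval $[1,w]$ in $(W,\preceq)$, graded by $l_T$. Every covering relation $(u,v)$ of $\mathrm{NC}_W(\gamma)$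 satisfies $u^{-1}v\in T$; the natural edge labeling is $\lambda(u,v)=u^{-1}v$. For a totally ordered label set, the label of an unrefinable chain $x_0<\cdots<x_r$ is $(\lambda(x_0,x_1),\dots,\lambda(x_{r-1},x_r))$; the chain is rising if its entries strictly increase; chains of equal length are compared by the lexicographic order on their labels. An edge labeling of a finite bounded graded poset is an EL-labeling if in every non-singleton interval there is a unique rising maximal chain and this chain is lexicographically smallest among all maximal chains of the interval. *)

(* Defs.v *)
From HB Require Import structures.
From mathcomp Require Import all_boot all_order all_fingroup.

Set Implicit Arguments.
Unset Strict Implicit.
Unset Printing Implicit Defensive.

Import Order.TTheory GroupScope.

(* In MathComp [(u * v)%g] applies [u] first; [u \oP v] is the composition of
   maps, with the rightmost factor applied first. *)
Definition perm_comp (X : finType) (u v : {perm X}) : {perm X} := v * u.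
Notation "u \oP v" := (perm_comp u v) (at level 40, left associativity).

(* The cycle (x_1, ..., x_k); [undup] makes the definition total, and is the
   identity on sequences of pairwise distinct points. *)
Definition cyc (X : finType) (s : seq X) : {perm X} :=
  perm (can_inj (prev_next (undup_uniq s))).

Section AbsoluteOrder.

Variables (X : finType) (T : {set {perm X}}).
Implicit Types u v w : {perm X}.

(* [T ^+ k] is the set of products of k elements of T.  The cut-off #|{perm X}|
   only matters outside <<T>>: see [abs_length_gen]. *)
Lemma abs_length_ex w : exists k, (w \in T ^+ k) || (#|{perm X}| <= k)%N.
Proof. by exists #|{perm X}|; rewrite leqnn orbT. Qed.

Definition abs_length w : nat := ex_minn (abs_length_ex w).

Definition abs_le u v : bool :=
  (abs_length u + abs_length (u^-1 \oP v) == abs_length v)%N.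

Lemma abs_lengthP w k : w \in T ^+ k -> (abs_length w <= k)%N.
Proof.
by move=> wk; rewrite /abs_length; case: ex_minnP => m _; apply; rewrite wk.
Qed.

Lemma abs_length_card w : (abs_length w <= #|{perm X}|)%N.
Proof.
by rewrite /abs_length; case: ex_minnP => m _; apply; rewrite leqnn orbT.
Qed.

Lemma abs_length_mem w :
  (abs_length w < #|{perm X}|)%N -> w \in T ^+ abs_length w.
Proof.
rewrite /abs_length; case: ex_minnP => m /orP[//|le_m] _.
by rewrite ltnNge le_m.
Qed.

Lemma abs_length1 : abs_length 1 = 0%N.
Proof. by apply/eqP; rewrite -leqn0 abs_lengthP // expg0 set11. Qed.

Lemma abs_length_eq0 w : (abs_length w == 0%N) = (w == 1).
Proof.
apply/eqP/eqP=> [w0|->]; last exact: abs_length1.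
have : w \in T ^+ abs_length w.
  by apply: abs_length_mem; rewrite w0; apply/card_gt0P; exists 1.
by rewrite w0 expg0 => /set1P.
Qed.

Lemma abs_lengthM u v : (abs_length (u * v) <= abs_length u + abs_length v)%N.
Proof.
have [uN|/abs_length_mem uT] := leqP #|{perm X}| (abs_length u).
  by rewrite (leq_trans (abs_length_card _)) // (leq_trans uN) ?leq_addr.
have [vN|/abs_length_mem vT] := leqP #|{perm X}| (abs_length v).
  by rewrite (leq_trans (abs_length_card _)) // (leq_trans vN) ?leq_addl.
by apply: abs_lengthP; rewrite expgD; apply: mem_mulg.
Qed.

Lemma abs_length_gen w : w \in <<T>> ->
  w \in T ^+ abs_length w /\ (forall k, w \in T ^+ k -> abs_length w <= k)%N.
Proof.
move=> wT; split; last by move=> k; apply: abs_lengthP.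
have [k wk] : exists k, w \in T ^+ k.
  have [n [c cT ->]] := gen_prodgP wT; exists n.
  elim: n c cT => [|n IH] c cT; first by rewrite big_ord0 expg0 set11.
  rewrite big_ord_recr /= expgSr mem_mulg //.
  by apply: (IH (fun i => c (widen_ord (leqnSn n) i))).
pose m := ex_minn (ex_intro (fun k => w \in T ^+ k) k wk).
suff lt_m : (m < #|{perm X}|)%N.
  rewrite abs_length_mem // (leq_ltn_trans _ lt_m) //.
  by apply: abs_lengthP; rewrite /m; case: ex_minnP.
rewrite /m; case: ex_minnP => {wk m}m wm min_m.
have [d dT wE] : exists2 d : nat -> {perm X}, forall i, (i < m)%N -> d i \in T
                 & w = \prod_(i < m) d i.
  elim: m w wm {wT min_m} => [|m IH] w wm.
    by exists (fun=> 1) => //; rewrite big_ord0; apply/set1P.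
  move: wm; rewrite expgSr => /mulsgP[u t uT tT ->].
  have [d dT ->] := IH _ uT.
  exists (fun i => if i == m then t else d i) => [i|].
    by rewrite ltnS leq_eqVlt; case: eqP => //= _; apply: dT.
  rewrite big_ord_recr /= eqxx; congr (_ * _); apply: eq_bigr => i _.
  by rewrite ltn_eqF.
have prodT a b : (b <= m)%N -> (\prod_(a <= i < b) d i) \in T ^+ (b - a)%N.
  elim: b => [|b IH] lebm; first by rewrite big_geq // sub0n expg0 set11.
  have [ltab|leab] := ltnP b a.
    by rewrite big_geq // (eqP (_ : b.+1 - a == 0)%N) ?subn_eq0 // expg0 set11.
  rewrite big_nat_recr //= subSn // expgSr mem_mulg ?IH ?dT //.
  exact: ltnW.
pose p (i : 'I_m.+1) := \prod_(0 <= j < i) d j.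
suff p_inj : injective p by rewrite -[m.+1]card_ord -(card_codom p_inj) max_card.
suff p_neq (i j : 'I_m.+1) : (i < j)%N -> p i != p j.
  move=> i j /eqP pij; apply/val_inj.
  by case: (ltngtP i j) => // /p_neq; rewrite ?pij // eq_sym pij.
move=> ltij; apply/eqP => pij.
have lejm : (j <= m)%N by rewrite -ltnS.
have : w \in T ^+ (i + (m - j))%N.
  rewrite wE -(big_mkord xpredT d) (big_cat_nat (n := j)) //=.
  have := prodT j m (leqnn m); have := prodT 0%N i (leq_trans (ltnW ltij) lejm).
  rewrite -/(p i) -/(p j) -pij subn0 => pi pm.
  by rewrite expgD mem_mulg.
move/min_m; rewrite leqNgt => /negP[].
by rewrite -[X in (_ < X)%N](subnKC lejm) ltn_add2r.
Qed.

Lemma abs_le_refl : reflexive abs_le.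
Proof. by move=> u; rewrite /abs_le /perm_comp mulgV abs_length1 addn0. Qed.

Lemma abs_le_anti : antisymmetric abs_le.
Proof.
move=> u v /andP[/eqP uv /eqP vu]; apply/esym/eqP.
rewrite -(inj_eq (mulIg u^-1)) mulgV -abs_length_eq0 -/(perm_comp _ _).
move: vu; rewrite -uv -addnA -[RHS]addn0 => /addnI/eqP.
by rewrite addn_eq0 => /andP[].
Qed.

Lemma abs_le_trans : transitive abs_le.
Proof.
move=> v u w /eqP uv /eqP vw; rewrite /abs_le eqn_leq; apply/andP; split.
  rewrite -vw -uv -addnA leq_add2l /perm_comp addnC.
  by rewrite (leq_trans _ (abs_lengthM _ _)) // mulgA mulgKV.
rewrite /perm_comp addnC (leq_trans _ (abs_lengthM _ _)) //.
by rewrite mulgKV.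
Qed.

End AbsoluteOrder.

Section NoncrossingPartitions.

Variables (X : finType) (W T : {set {perm X}}) (w : {perm X}).

Record NC := MkNC {
  NC_val :> {perm X};
  _ : (NC_val \in W) && abs_le T NC_val w
}.

HB.instance Definition _ := [isSub for NC_val].
HB.instance Definition _ := [Finite of NC by <:].

Definition NC_le (u v : NC) : bool := abs_le T u v.

Lemma NC_le_refl : reflexive NC_le.
Proof. by move=> u; apply: abs_le_refl. Qed.

Lemma NC_le_anti : antisymmetric NC_le.
Proof. by move=> u v /abs_le_anti/val_inj. Qed.

Lemma NC_le_trans : transitive NC_le.
Proof. by move=> v u t; apply: abs_le_trans. Qed.

Fact NC_display : Order.disp_t. Proof. exact: Order.Disp tt tt. Qed.

HB.instance Definition _ :=
  Order.Le_isPOrder.Build NC_display NC NC_le_refl NC_le_anti NC_le_trans.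

Definition natural_label (u v : NC) : {perm X} := (u : {perm X})^-1 \oP v.

End NoncrossingPartitions.

Section ELLabeling.

Variables (d : Order.disp_t) (P : finPOrderType d).
Variables (L : finType) (labels : {set L}) (ltL : rel L) (lam : P -> P -> L).

Definition covers (x y : P) : bool :=
  (x < y)%O && [forall z, ~~ (x < z < y)%O].

(* x :: s is a maximal chain of the interval [x, y]. *)
Definition maximal_chain (x y : P) (s : seq P) : bool :=
  path covers x s && (last x s == y).

Definition bounded_graded : Prop :=
  exists bot top : P,
    (forall x : P, (bot <= x <= top)%O) /\
    (forall s s', maximal_chain bot top s -> maximal_chain bot top s' ->
       size s = size s').

Definition chain_label (x : P) (s : seq P) : seq L := pairmap lam x s.

Definition rising (x : P) (s : seq P) : bool := sorted ltL (chain_label x s).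

Fixpoint lexlt (a b : seq L) : bool :=
  match a, b with
  | x :: a', y :: b' => ltL x y || (x == y) && lexlt a' b'
  | _, _ => false
  end.

Definition EL_labeling : Prop :=
  [/\ bounded_graded,
      (forall x y, covers x y -> lam x y \in labels)
    & (forall x y, (x < y)%O ->
         exists s, [/\ maximal_chain x y s,
                       rising x s,
                       (forall s', maximal_chain x y s' -> rising x s' -> s' = s)
                     & (forall s', maximal_chain x y s' -> s' != s ->
                          lexlt (chain_label x s) (chain_label x s'))])].

End ELLabeling.

Definition strict_total_order_on (L : finType) (A : {set L}) (lt : rel L) : Prop :=
  [/\ {in A, forall x, ~~ lt x x},
      {in A & &, forall x y z, lt x y -> lt y z -> lt x z}
    & {in A &, forall x y, x != y -> lt x y || lt y x}].

(* For every n, the index i : 'I_n stands for the number i + 1, so that an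
   informal condition j <= n - 1 becomes (j < n.-1)%N. *)

Section TypeA.

Variable n : nat.

Definition WA : {set {perm 'I_n}} := [set: {perm 'I_n}].

Definition TA : {set {perm 'I_n}} :=
  [set t | [exists i : 'I_n, exists j : 'I_n, (i < j)%N && (t == tperm i j)]].

Definition coxA : {perm 'I_n} := cyc (enum 'I_n).

Definition compatibleA (lt : rel {perm 'I_n}) : Prop :=
  forall i j k : 'I_n, (i < j < k)%N ->
    lt (tperm i j) (tperm i k) /\ lt (tperm i k) (tperm j k).

End TypeA.

Section SignedPermutations.

Variable n : nat.

(* (i, b) is the letter i + 1 of {1, ..., n, -1, ..., -n}, negated iff b. *)
Definition letter : finType := ('I_n * bool)%type.

Definition pos (i : 'I_n) : letter := (i, false).
Definition neg (i : 'I_n) : letter := (i, true).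
Definition opp (x : letter) : letter := (x.1, ~~ x.2).

(* ((x_1, ..., x_k)) *)
Definition pcyc (s : seq letter) : {perm letter} := cyc s \oP cyc (map opp s).

(* [x_1, ..., x_k] *)
Definition bcyc (s : seq letter) : {perm letter} := cyc (s ++ map opp s).

Definition refl2 (x y : letter) : {perm letter} := pcyc [:: x; y].
Definition refl1 (i : 'I_n) : {perm letter} := bcyc [:: pos i].

Definition WB : {set {perm letter}} :=
  [set w : {perm letter} | [forall x, w (opp x) == opp (w x)]].

Definition TD : {set {perm letter}} :=
  [set t | [exists i : 'I_n, exists j : 'I_n, (i < j)%N &&
             ((t == refl2 (pos i) (pos j)) || (t == refl2 (pos i) (neg j)))]].

Definition TB : {set {perm letter}} := TD :|: [set refl1 i | i : 'I_n].

Definition WD : {set {perm letter}} := <<TD>>.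

Definition coxB : {perm letter} := bcyc [seq pos i | i <- enum 'I_n].

Definition coxD : {perm letter} :=
  bcyc [seq pos i | i : 'I_n <- enum 'I_n & (i < n.-1)%N] \oP
  bcyc [seq pos i | i : 'I_n <- enum 'I_n & i == n.-1 :> nat].

Definition compatibleB (lt : rel {perm letter}) : Prop :=
  [/\ (forall i j k : 'I_n, (i < j < k)%N ->
         lt (refl2 (pos i) (pos j)) (refl2 (pos i) (pos k)) /\
         lt (refl2 (pos i) (pos k)) (refl2 (pos j) (pos k))),
      (forall i j k : 'I_n, (i < j)%N -> (k < i)%N || (j < k)%N ->
         lt (refl2 (pos i) (pos j)) (refl2 (pos i) (neg k)) /\
         lt (refl2 (pos i) (neg k)) (refl2 (pos j) (neg k)))
    & (forall i j : 'I_n, (i < j)%N ->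
         [/\ lt (refl2 (pos i) (pos j)) (refl1 i),
             lt (refl1 i) (refl2 (pos i) (neg j))
           & lt (refl2 (pos i) (neg j)) (refl1 j)])].

Definition compatibleD (lt : rel {perm letter}) : Prop :=
  [/\ (forall i j k : 'I_n, (i < j < k)%N ->
         lt (refl2 (pos i) (pos j)) (refl2 (pos i) (pos k)) /\
         lt (refl2 (pos i) (pos k)) (refl2 (pos j) (pos k))),
      (forall i j k : 'I_n, (i < j < n.-1)%N -> (k < i)%N || (j < k)%N ->
         lt (refl2 (pos i) (pos j)) (refl2 (pos i) (neg k)) /\
         lt (refl2 (pos i) (neg k)) (refl2 (pos j) (neg k)))
    & (forall (i j m : 'I_n) (b b' : bool),
         (i < j < n.-1)%N -> m = n.-1 :> nat ->
         lt (refl2 (pos i) (m, b)) (refl2 (pos i) (neg j)) /\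
         lt (refl2 (pos i) (neg j)) (refl2 (pos j) (m, b')))].

End SignedPermutations.

(* Main.v *)
(* Let gamma act on Q^n with its roots as row vectors, and let K be a matrix with
   alpha K (gamma - 1) = alpha for every root alpha, so that chi(a, b) = a K b^T is
   the Wall form of gamma.  If gamma = t_1 ... t_r is reduced, the roots alpha_i are
   linearly independent and chi(alpha_i, alpha_j) = 0 for i < j.  For each of the
   three types, compatibility of < says exactly that the roots of t < u with
   chi = 0 form a non-acute angle.  Hence the roots of a rising factorization of w
   form the simple system of a parabolic subgroup that depends only on w: a root in
   their span has integral coordinates (triangularity of chi), and these have equal
   signs (split the root into its positive and negative parts and compare norms).
   Two such systems are nonnegative integral combinations of one another, hence
   equal, and sorting recovers the factorization.  Existence of a rising chain, and
   its lexicographic minimality, hold for every total order on T: the greedy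
   factorization is rising by the exchange m t = t (t^-1 m t). *)

Require Import Defs.
From mathcomp Require Import all_boot all_order all_fingroup all_algebra.
From mathcomp Require Import zify ring lra.

Set Implicit Arguments.
Unset Strict Implicit.
Unset Printing Implicit Defensive.

Import Order.TTheory.

(** * Reduced words and chains *)

(** No interval is ever classified: a reduced word of u^-1 v is completed on both sides to a reduced
    word of gamma, so whatever is special to a type concerns gamma alone. The only length
    computation asks that l_T(gamma) be at most the rank of gamma - 1; this squeezes the ranks
    attached to all subwords. The obstacle is type B, with roots of two lengths. There chi is only
    half-integral against a short root, and a combination of simple roots that involves one may have
    norm 1, which ruins the comparison of norms behind equal signs. The remedy is that chi never
    vanishes on two short roots: a triangular family then contains at most one of them, so at most
    one of the two parts of a root is affected. In type A, gamma - 1 is singular and K inverts it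
    only on the span of the roots; in types B and D, K is a true inverse. *)

Section Words.

Import GroupScope.

Variables (X : finType) (T : {set {perm X}}).
Implicit Types (u v w t : {perm X}) (s : seq {perm X}).

(** The head of a word is the outermost map, as in the label of a chain read upwards; in the
    MathComp product, which applies its left factor first, the letters therefore appear reversed. *)
Definition wprod s : {perm X} := foldr (fun t w => t \oP w) 1 s.

#[local] Arguments wprod : simpl never.

Definition reduced w s : bool :=
  [&& all (mem T) s, wprod s == w & size s == abs_length T w].

Lemma wprod_cons t s : wprod (t :: s) = wprod s * t.
Proof. by []. Qed.

Lemma wprod_cat s1 s2 : wprod (s1 ++ s2) = wprod s2 * wprod s1.
Proof.
elim: s1 => [|t s1 IH]; first by rewrite mulg1.
by rewrite cat_cons !wprod_cons IH mulgA.
Qed.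

Lemma wprod_mem s : all (mem T) s -> wprod s \in T ^+ size s.
Proof.
elim: s => [|t s IH] /=; first by rewrite expg0 set11.
by case/andP=> tT /IH sT; rewrite expgSr mem_mulg.
Qed.

Lemma abs_length_wprod s : all (mem T) s -> (abs_length T (wprod s) <= size s)%N.
Proof. by move=> /wprod_mem; apply: abs_lengthP. Qed.

Lemma abs_length_refl t : t \in T -> (abs_length T t <= 1)%N.
Proof. by move=> tT; apply: abs_lengthP; rewrite expg1. Qed.

Lemma mem_wprod w k :
  w \in T ^+ k -> exists s, [/\ all (mem T) s, wprod s = w & size s = k].
Proof.
elim: k w => [|k IH] w; first by rewrite expg0 => /set1P->; exists [::].
rewrite expgSr => /mulsgP[u t uT tT ->].
by have [s [sT <- <-]] := IH _ uT; exists (t :: s); split; rewrite //= tT sT.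
Qed.

(** The bound keeps [w] away from the cut-off value of [abs_length], at which no word need exist. *)
Lemma reduced_ex w : (abs_length T w < #|{perm X}|)%N -> exists s, reduced w s.
Proof.
move/abs_length_mem/mem_wprod => [s [sT sw ss]].
by exists s; rewrite /reduced sT sw ss !eqxx.
Qed.

Lemma reduced_leq s : all (mem T) s ->
  (size s <= abs_length T (wprod s))%N -> reduced (wprod s) s.
Proof.
by move=> sT le; rewrite /reduced sT eqxx eqn_leq le abs_length_wprod.
Qed.

(** Subadditivity leaves no slack: a shorter word for either factor would shorten the whole. *)
Lemma reduced_cat w s1 s2 : reduced w (s1 ++ s2) ->
  [/\ reduced (wprod s1) s1, reduced (wprod s2) s2
    & abs_length T w = (abs_length T (wprod s1) + abs_length T (wprod s2))%N].
Proof.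
case/and3P; rewrite all_cat => /andP[T1 T2] /eqP <-; rewrite size_cat wprod_cat.
have := abs_lengthM T (wprod s2) (wprod s1).
have := abs_length_wprod T1; have := abs_length_wprod T2 => l2 l1 l3 /eqP ss.
by split; first [apply: reduced_leq => //; lia | lia].
Qed.

Lemma reduced_cons w t s : reduced w (t :: s) ->
  [/\ t \in T, reduced (w * t^-1) s
    & abs_length T w = (abs_length T (w * t^-1)).+1].
Proof.
move=> r; have /and3P[/= /andP[tT _] /eqP wE _] := r; split=> //.
  by have [] := reduced_cat (r : reduced w ([:: t] ++ s)); rewrite -wE wprod_cons mulgK.
have [/and3P[_ _ /eqP r1] _ ->] := reduced_cat (r : reduced w ([:: t] ++ s)).
by rewrite -r1 -wE wprod_cons mulgK.
Qed.

Lemma cons_reduced w t s : t \in T -> reduced (w * t^-1) s ->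
  (abs_length T (w * t^-1) < abs_length T w)%N -> reduced w (t :: s).
Proof.
move=> tT /and3P[sT /eqP sw /eqP ss] lt.
have wE : wprod (t :: s) = w by rewrite wprod_cons sw mulgKV.
by rewrite -{1}wE reduced_leq //= ?tT // wE ss.
Qed.

(** * Greedy reduced words *)

Section GreedyWord.

Variable lt : rel {perm X}.
Hypothesis lt_total : strict_total_order_on T lt.

Lemma exists_min (A : {set {perm X}}) : A \subset T -> A != set0 ->
  exists2 m, m \in A & forall t, t \in A -> t != m -> lt m t.
Proof.
have [_ ltT ltC] := lt_total.
move=> AT /set0Pn[a aA].
have: a \in enum A by rewrite mem_enum.
have: {subset enum A <= T} by move=> x; rewrite mem_enum; apply: (subsetP AT).
suff: forall s b, b \in s -> {subset s <= T} ->
  exists2 m, m \in s & forall t, t \in s -> t != m -> lt m t.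
  move=> H sT sa; have [m mA mM] := H _ _ sa sT.
  by exists m => [|t]; [rewrite -mem_enum | rewrite -mem_enum; apply: mM].
elim=> [|b s IH] // _ _ sT.
have bT : b \in T by apply: sT; rewrite mem_head.
case: s IH sT => [|c s] IH sT.
  exists b; first exact: mem_head.
  by move=> t; rewrite inE => /eqP->; rewrite eqxx.
have [|m ms mM] := IH c (mem_head _ _).
  by move=> x xs; apply: sT; rewrite inE xs orbT.
have mT : m \in T by apply: sT; rewrite inE ms orbT.
have [bm|nbm] := boolP ((b == m) || lt m b).
  exists m; first by rewrite inE ms orbT.
  move=> t; rewrite inE => /orP[/eqP-> bm'|]; last exact: mM.
  by move: bm; rewrite (negbTE bm').
move: nbm; rewrite negb_or => /andP[bm nmb].
have lbm : lt b m by move: (ltC _ _ bT mT bm); rewrite (negbTE nmb) orbF.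
exists b; first exact: mem_head.
move=> t; rewrite inE => /orP[/eqP->|ts tb]; first by rewrite eqxx.
have tT : t \in T by apply: sT; rewrite inE ts orbT.
have [->//|tm] := eqVneq t m.
exact: ltT lbm (mM _ ts tm).
Qed.

Hypothesis T_conj : {in T &, forall t u, t ^ u \in T}.
Hypothesis T_invol : {in T, forall t, t^-1 = t}.

(* If the second letter [t] of a greedy word were smaller than the first letter
   [m], the exchange [m t = t (t^-1 m t)] would produce a smaller first letter. *)
Lemma greedy_word w : (abs_length T w < #|{perm X}|)%N ->
  exists s, [/\ reduced w s, sorted lt s &
    forall s', reduced w s' -> s' != s -> lexlt lt s s'].
Proof.
have [k] := ubnP (abs_length T w); elim: k w => // k IH w wk wX.
(* [A] is the set of possible first letters of reduced words of [w]: [inA] gives one inclusion and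
   [cons_reduced] the other. *)
pose A := [set t in T | (abs_length T (w * t^-1) < abs_length T w)%N].
have AT : A \subset T by apply/subsetP => t; rewrite inE => /andP[].
have inA t s : reduced w (t :: s) -> t \in A.
  by case/reduced_cons => tT _ lw; rewrite inE tT lw leqnn.
have [A0|An0] := eqVneq A set0.
  have [s rs] := reduced_ex wX.
  case: s rs => [|t s] rs; last by move: (inA _ _ rs); rewrite A0 inE.
  by exists [::]; split=> // -[|t s'] // /inA; rewrite A0 inE.
have [m mA mM] := exists_min AT An0.
have /andP[mT mw] : (m \in T) && (abs_length T (w * m^-1) < abs_length T w)%N.
  by move: mA; rewrite inE.
have [||s [rs ss sM]] := IH (w * m^-1); [lia | lia |].
have rms := cons_reduced mT rs mw.
exists (m :: s); split=> //.
  case: s rs ss sM rms => [|t s] rs ss sM rms //=; move: ss => /= ->; rewrite andbT.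
  have [_ _ l1] := reduced_cons rms; have [tT _ l2] := reduced_cons rs.
  apply: mM.
    rewrite inE tT /=.
    have -> : w * t^-1 = w * m^-1 * t^-1 * m ^ t^-1.
      by rewrite conjgE invgK !mulgA mulgKV mulgKV.
    have := abs_lengthM T (w * m^-1 * t^-1) (m ^ t^-1).
    have : (abs_length T (m ^ t^-1) <= 1)%N.
      by rewrite (T_invol tT) abs_length_refl // T_conj.
    lia.
  (* Two equal leading letters would cancel, [m] being an involution, although the length drops at
     both. *)
  apply/eqP => tm.
  by move: l2; rewrite tm {3}(T_invol mT) mulgKV; lia.
move=> [|t s'] rs'.
  by case/and3P: rs' => _ _ /eqP; case/and3P: rms => _ _ /eqP /= <-.
rewrite eqseq_cons /= [m == t]eq_sym; have [tm|tm] /= := eqVneq t m => ne.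
  by rewrite sM ?orbT //; have [] := reduced_cons rs'; rewrite tm.
by rewrite mM // (inA _ _ rs').
Qed.
End GreedyWord.
End Words.

#[local] Arguments wprod : simpl never.

(** * Maximal chains as reduced words *)

Section NoncrossingChains.

Import GroupScope.

Variables (X : finType) (W T : {set {perm X}}) (g : {perm X}).
Variable lt : rel {perm X}.

Hypothesis W1 : 1 \in W.
Hypothesis W_mul : forall t w : {perm X}, t \in T -> w \in W -> t * w \in W.
Hypothesis gW : g \in W.
Hypothesis g_short : (abs_length T g < #|{perm X}|)%N.

Notation NCg := (NC W T g).
Notation pv := (@NC_val X W T g).
Notation len := (abs_length T).
Implicit Types (u v z : NCg) (t : {perm X}) (s : seq {perm X}) (c : seq NCg).

Lemma NC_eqP u v : pv v * (pv u)^-1 = 1 -> v = u.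
Proof.
by move=> e; apply: val_inj; apply: (mulIg (pv u)^-1); rewrite mulgV.
Qed.

Lemma NC_W u : pv u \in W.
Proof. by case: u => u /= /andP[]. Qed.

Lemma NC_leg u : (len (pv u) + len (g * (pv u)^-1))%N = len g.
Proof. by case: u => u /= /andP[_ /eqP]. Qed.

Lemma NC_leE u v : (u <= v)%O = (len (pv u) + len (pv v * (pv u)^-1) == len (pv v))%N.
Proof. by []. Qed.

Lemma NC_lt_len u v : (u < v)%O -> (len (pv u) < len (pv v))%N.
Proof.
rewrite lt_def NC_leE => /andP[ne /eqP <-].
rewrite -[X in (X < _)%N]addn0 ltn_add2l lt0n abs_length_eq0.
by apply: contra ne => /eqP/NC_eqP->.
Qed.

Lemma NC_len_lt u v : (u <= v)%O -> (len (pv u) < len (pv v))%N -> (u < v)%O.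
Proof. by move=> uv l; rewrite lt_def uv andbT; apply: contraTneq l => ->; lia. Qed.

(** The triangle inequality along u, u1, v forces the length of [t * pv u] to be exactly one more
    than that of [u]; transitivity through [v] keeps the new element below [g], and consecutive
    lengths leave room for nothing in between. *)
Lemma NC_step u v t s : (u <= v)%O -> reduced T (pv v * (pv u)^-1) (t :: s) ->
  exists u1 : NCg, [/\ pv u1 = t * pv u, covers u u1, (u1 <= v)%O
    & reduced T (pv v * (pv u1)^-1) s].
Proof.
rewrite NC_leE => /eqP uv r; have [tT rs l1] := reduced_cons r.
have vE : pv v * (t * pv u)^-1 = pv v * (pv u)^-1 * t^-1 by rewrite invMg mulgA.
have l2 := abs_lengthM T t (pv u); have l3 := abs_length_refl tT.
have := abs_lengthM T (pv v * (t * pv u)^-1) (t * pv u); rewrite mulgKV vE => l4.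
have l5 : len (t * pv u) = (len (pv u)).+1 by lia.
have u1v : abs_le T (t * pv u) (pv v) by rewrite /abs_le /perm_comp vE; lia.
have u1g : (t * pv u \in W) && abs_le T (t * pv u) g.
  rewrite W_mul ?NC_W // (abs_le_trans u1v) //.
  by have := NC_leg v; rewrite /abs_le => ->.
pose u1 : NCg := MkNC u1g; exists u1; split=> //; last by rewrite vE.
have uu1 : (u <= u1)%O by rewrite NC_leE /= mulgK; lia.
rewrite /covers NC_len_lt //=; last by rewrite l5.
by apply/forallP => z; apply/negP => /andP[/NC_lt_len a /NC_lt_len /=]; lia.
Qed.

(** With its converse [word_of_chain] and with [chain_label_inj], this identifies the maximal chains
    of [u, v] with the reduced words of u^-1 v, labels becoming letters. *)
Lemma chain_of_word s u v : (u <= v)%O -> reduced T (pv v * (pv u)^-1) s ->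
  exists2 c, maximal_chain u v c & chain_label (@natural_label _ W T g) u c = s.
Proof.
elim: s u => [|t s IH] u uv r.
  exists [::] => //; rewrite /maximal_chain /=.
  case/and3P: r => _ /eqP/esym vu _.
  by rewrite (NC_eqP vu).
have [u1 [u1E cu u1v r1]] := NC_step uv r.
have [c mc lc] := IH _ u1v r1; exists (u1 :: c).
  by move: mc; rewrite /maximal_chain /= cu.
by rewrite /chain_label /= -/(chain_label _ _ _) lc /natural_label /perm_comp u1E mulgK.
Qed.

Lemma NC_reduced_ex u v : (u <= v)%O -> exists s, reduced T (pv v * (pv u)^-1) s.
Proof.
rewrite NC_leE => /eqP uv; apply: reduced_ex.
by have := NC_leg v; lia.
Qed.

(** The first letter of a reduced word of u^-1 v yields an element above [u] and weakly below [v],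
    which a covering relation forces to be [v] itself. *)
Lemma covers_label u v : covers u v ->
  pv v * (pv u)^-1 \in T /\ len (pv v) = (len (pv u)).+1.
Proof.
move=> /andP[uv /forallP nz].
have [s r] := NC_reduced_ex (ltW uv).
case: s r => [|t s] r.
  have := NC_lt_len uv; have := ltW uv; rewrite NC_leE.
  by case/and3P: r => _ _ /eqP /=; lia.
have [u1 [u1E cu u1v r1]] := NC_step (ltW uv) r.
have u1_v : u1 = v.
  apply/eqP; have := nz u1; move: cu => /andP[-> _] /=.
  by rewrite lt_neqAle u1v andbT negbK.
have [tT _ _] := reduced_cons r.
have vE : pv v * (pv u)^-1 = t by rewrite -u1_v u1E mulgK.
split; first by rewrite vE.
have := NC_lt_len uv; have := ltW uv; rewrite NC_leE vE.
by have := abs_length_refl tT; lia.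
Qed.

Lemma path_len c u v : path (@covers _ NCg) u c -> last u c = v ->
  (u <= v)%O /\ len (pv v) = (len (pv u) + size c)%N.
Proof.
elim: c u => [|x c IH] u /=; first by move=> _ ->; rewrite addn0.
move=> /andP[ux px] /(IH _ px)[xv ->].
have [_ ->] := covers_label ux.
by split; [case/andP: ux => /ltW /le_trans ux _; apply: ux | lia].
Qed.

Lemma word_of_chain c u v : maximal_chain u v c ->
  reduced T (pv v * (pv u)^-1) (chain_label (@natural_label _ W T g) u c).
Proof.
case/andP=> pc /eqP lc; have [uv lv] := path_len pc lc.
have sz : size (chain_label (@natural_label _ W T g) u c) = len (pv v * (pv u)^-1).
  by rewrite size_pairmap; move: uv; rewrite NC_leE lv => /eqP/addnI.
rewrite /reduced sz eqxx andbT; move: {uv lv sz} pc lc.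
elim: c u => [|x c IH] u /=; first by move=> _ ->; rewrite mulgV /wprod /= eqxx.
move=> /andP[ux px] /(IH _ px)/andP[-> /eqP]; rewrite /chain_label => wE.
rewrite wprod_cons wE /natural_label /perm_comp !mulgA mulgKV eqxx andbT.
by have [-> _] := covers_label ux.
Qed.

Lemma chain_label_inj u c c' :
  chain_label (@natural_label _ W T g) u c = chain_label (@natural_label _ W T g) u c' ->
  c = c'.
Proof.
elim: c u c' => [|x c IH] u [|x' c'] //= [/mulIg/val_inj <-].
by move=> /IH <-.
Qed.

Hypothesis lt_total : strict_total_order_on T lt.
Hypothesis T_conj : {in T &, forall t w : {perm X}, t ^ w \in T}.
Hypothesis T_invol : {in T, forall t, t^-1 = t}.
(** Uniqueness is asked only for factors of reduced words of [g]. The words of an interval [u, v]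
    become such factors once a reduced word of u is put on their left and one of v^-1 g on their
    right. *)
Hypothesis rising_unique : forall s1 s s' s2,
  reduced T g (s1 ++ s ++ s2) -> reduced T g (s1 ++ s' ++ s2) ->
  wprod s = wprod s' -> sorted lt s -> sorted lt s' -> s = s'.

Lemma EL_labeling_of_rising_unique :
  EL_labeling T lt (@natural_label _ W T g).
Proof.
have b1 : (1 \in W) && abs_le T 1 g.
  by rewrite W1 /abs_le abs_length1 /perm_comp invg1 mulg1 eqxx.
have bg : (g \in W) && abs_le T g g by rewrite gW abs_le_refl.
have leg u : (u <= MkNC bg)%O by rewrite NC_leE NC_leg.
split.
- exists (MkNC b1), (MkNC bg); split=> [u|c c'].
    rewrite leg andbT NC_leE /= abs_length1 invg1 mulg1 eqxx //.
  move=> /andP[p /eqP l] /andP[p' /eqP l'].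
  by have [_] := path_len p l; have [_ ->] := path_len p' l' => /addnI.
- by move=> u v /covers_label[].
move=> u v uv; have uv' := ltW uv.
have [|s [rs ss sM]] := greedy_word lt_total T_conj T_invol (w := pv v * (pv u)^-1).
  by move: uv'; rewrite NC_leE; have := NC_leg v; lia.
have [c mc lc] := chain_of_word uv' rs.
exists c; split; rewrite /rising ?lc //.
  move=> c' mc' ss'; apply: (@chain_label_inj u); rewrite lc.
  have rs' := word_of_chain mc'.
  have lu : (len (pv u) < #|{perm X}|)%N.
    by rewrite (leq_ltn_trans _ g_short) // -(NC_leg u) leq_addr.
  have lv : (len (g * (pv v)^-1) < #|{perm X}|)%N.
    by rewrite (leq_ltn_trans _ g_short) // -(NC_leg v) leq_addl.
  have [s1 r1] := reduced_ex lu.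
  have [s2 r2] := reduced_ex lv.
  have red x : reduced T (pv v * (pv u)^-1) x -> reduced T g (s1 ++ x ++ s2).
    case/and3P: r1 => a1 /eqP b1' /eqP c1; case/and3P: r2 => a2 /eqP b2 /eqP c2.
    case/and3P=> a3 /eqP b3 /eqP c3.
    rewrite /reduced !all_cat a1 a2 a3 !wprod_cat b1' b2 b3 !size_cat c1 c2 c3.
    have -> : g * (pv v)^-1 * (pv v * (pv u)^-1) * pv u = g by rewrite mulgA !mulgKV.
    rewrite eqxx /= addnA.
    move: uv'; rewrite NC_leE => /eqP ->.
    by rewrite NC_leg.
  apply: (rising_unique (red _ rs') (red _ rs)) => //.
  by case/and3P: rs' => _ /eqP-> _; case/and3P: rs => _ /eqP-> _.
move=> c' mc' ne; apply: sM; first exact: word_of_chain.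
by apply: contra ne => /eqP e; apply/eqP; apply: (@chain_label_inj u); rewrite e lc.
Qed.

End NoncrossingChains.

Import GRing.Theory Num.Theory.
Local Open Scope ring_scope.

(** * Simple systems for a Wall form *)

Section Forms.

Variable n : nat.
Implicit Types x y : 'rV[rat]_n.

Definition form (K : 'M[rat]_n) x y : rat := (x *m K *m y^T) 0 0.
Definition dot := form 1%:M.

Lemma form_suml K k (c : 'rV_k) (A : 'M_(k, n)) y :
  form K (c *m A) y = \sum_i c 0 i * form K (row i A) y.
Proof.
rewrite /form [c *m A]mulmx_sum_row !mulmx_suml summxE.
by apply: eq_bigr => i _; rewrite -!scalemxAl mxE.
Qed.

Lemma form_sumr K k (c : 'rV_k) (A : 'M_(k, n)) x :
  form K x (c *m A) = \sum_i c 0 i * form K x (row i A).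
Proof.
rewrite /form [c *m A]mulmx_sum_row !linear_sum /= summxE.
by apply: eq_bigr => i _; rewrite linearZ -scalemxAr mxE.
Qed.

Lemma formBl K x x' y : form K (x - x') y = form K x y - form K x' y.
Proof. by rewrite /form !mulmxBl !mxE. Qed.

Lemma formBr K x y y' : form K x (y - y') = form K x y - form K x y'.
Proof. by rewrite /form linearB /= mulmxBr !mxE. Qed.

Lemma dotE x y : dot x y = \sum_i x 0 i * y 0 i.
Proof.
by rewrite /dot /form mulmx1 mxE; apply: eq_bigr => i _; rewrite mxE.
Qed.

Lemma dotC x y : dot x y = dot y x.
Proof. by rewrite !dotE; apply: eq_bigr => i _; rewrite mulrC. Qed.

Lemma dot_ge0 x : 0 <= dot x x.
Proof. by rewrite dotE sumr_ge0 // => i _; rewrite -expr2 sqr_ge0. Qed.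

Lemma dot_eq0 x : (dot x x == 0) = (x == 0).
Proof.
apply/idP/eqP=> [|->]; last by rewrite dotE big1 // => i _; rewrite mxE mul0r.
rewrite dotE psumr_eq0 => [/allP x0|i _]; last by rewrite -expr2 sqr_ge0.
apply/rowP => i; apply/eqP; rewrite mxE -sqrf_eq0 expr2.
exact: (x0 i (mem_index_enum _)).
Qed.

End Forms.

(** * Coordinates of roots in a simple system *)

Section SimpleSystems.

Variables (n : nat) (K : 'M[rat]_n) (ht : 'cV[rat]_n) (root : 'rV[rat]_n -> Prop).
Notation chi := (form K).
Notation height x := ((x *m ht) 0 0).

(** For a Wall form this expresses that the group element is orthogonal. At x = y it pins chi to
    minus half the norm, which supplies the pivots -1 and -1/2. *)
Hypothesis chi_sym : forall x y, root x -> root y -> chi x y + chi y x = - dot x y.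
Hypothesis root_norm : forall x, root x -> dot x x = 1 \/ dot x x = 2%:R.
Hypothesis chi_long : forall x y, root x -> root y -> dot y y = 2%:R ->
  chi x y \is a Num.int.
Hypothesis chi_short : forall x y, root x -> root y -> dot y y = 1 ->
  2%:R * chi x y \is a Num.int.
(** Consequently a family on which chi is triangular has at most one short member. *)
Hypothesis chi_short_neq0 : forall x y, root x -> root y ->
  dot x x = 1 -> dot y y = 1 -> chi x y != 0.
Hypothesis root_height : forall x, root x -> 0 < height x.

(* The rows of [A] behave as the simple roots of a parabolic subgroup. *)
Definition simple_rows k (A : 'M[rat]_(k, n)) : Prop :=
  [/\ forall i, root (row i A),
      forall i j : 'I_k, (i < j)%N -> chi (row i A) (row j A) = 0
    & forall i j : 'I_k, i != j -> dot (row i A) (row j A) <= 0].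

Lemma chi_diag x : root x -> chi x x = - (dot x x / 2%:R).
Proof. by move=> rx; have := chi_sym rx rx; lra. Qed.

(** Pairing with row i on the right kills the rows before it, so the coordinates are solved for from
    the last to the first. The pivot is -1 for a long row, where chi is integral, and -1/2 for a
    short one, where the equation is doubled first. *)
Lemma simple_coef_int k (A : 'M_(k, n)) (c : 'rV_k) : simple_rows A ->
  root (c *m A) -> forall i, c 0 i \is a Num.int.
Proof.
move=> [rA tri _] rc i.
have [m] := ubnP (k - i); elim: m i => // m IH i im.
have ri := rA i.
have e : chi (c *m A) (row i A) =
    c 0 i * chi (row i A) (row i A) +
    \sum_(j : 'I_k | (i < j)%N) c 0 j * chi (row j A) (row i A).
  rewrite form_suml (bigD1 i) //=; congr (_ + _).
  rewrite (bigID (fun j : 'I_k => (i < j)%N)) /= [X in _ + X]big1 => [|j].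
    rewrite addr0; apply: eq_bigl => j; rewrite andbC -val_eqE /=.
    by case: ltngtP.
  rewrite -leqNgt leq_eqVlt -val_eqE /= => /andP[/negbTE-> /= ji].
  by rewrite tri // mulr0.
rewrite chi_diag // in e.
case: (root_norm ri) => ni.
  have -> : c 0 i = \sum_(j : 'I_k | (i < j)%N) c 0 j * (2%:R * chi (row j A) (row i A))
       - 2%:R * chi (c *m A) (row i A).
    rewrite e ni mulrDr mulr_sumr.
    under [in RHS]eq_bigr do rewrite mulrCA.
    by rewrite opprD addrCA subrr addr0; field.
  rewrite rpredB ?chi_short // rpred_sum // => j ij.
  by rewrite rpredM ?chi_short ?IH //; have := ltn_ord j; lia.
have -> : c 0 i = \sum_(j : 'I_k | (i < j)%N) c 0 j * chi (row j A) (row i A)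
     - chi (c *m A) (row i A).
  by rewrite e ni opprD addrCA subrr addr0; field.
rewrite rpredB ?chi_long // rpred_sum // => j ij.
by rewrite rpredM ?chi_long ?IH //; have := ltn_ord j; lia.
Qed.

(** The symmetrization of chi is available on roots only, hence the double expansion over rows, in
    which the pairs (i, j) and (j, i) are combined. *)
Lemma dot_chi k (A : 'M_(k, n)) (c : 'rV_k) : (forall i, root (row i A)) ->
  dot (c *m A) (c *m A) = - (2%:R * chi (c *m A) (c *m A)).
Proof.
move=> rA.
have formE M : form M (c *m A) (c *m A) =
    \sum_i \sum_j c 0 i * (c 0 j * form M (row i A) (row j A)).
  rewrite form_suml; apply: eq_bigr => i _.
  by rewrite form_sumr mulr_sumr.
have chiE : chi (c *m A) (c *m A) =
    \sum_i \sum_j c 0 i * (c 0 j * chi (row j A) (row i A)).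
  rewrite formE exchange_big; apply: eq_bigr => i _; apply: eq_bigr => j _.
  by rewrite mulrCA.
have -> : 2%:R * chi (c *m A) (c *m A) = chi (c *m A) (c *m A) + chi (c *m A) (c *m A).
  by ring.
rewrite {1}formE chiE -big_split -sumrN /dot formE.
apply: eq_bigr => i _; rewrite -big_split -sumrN; apply: eq_bigr => j _ /=.
rewrite -/(dot _ _) -[dot _ _]opprK -chi_sym //; ring.
Qed.

(** If no short row contributes, chi is an integer on the combination, and the norm, being -2 chi,
    is an even integer. *)
Lemma simple_even_norm k (A : 'M_(k, n)) (c : 'rV_k) :
  (forall i, root (row i A)) -> (forall i, c 0 i \is a Num.int) ->
  (forall i, dot (row i A) (row i A) = 1 -> c 0 i = 0) ->
  c *m A = 0 \/ 2%:R <= dot (c *m A) (c *m A).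
Proof.
move=> rA ci c0.
have [/intrP[z zE]] : chi (c *m A) (c *m A) \is a Num.int.
  rewrite form_suml rpred_sum // => i _; rewrite rpredM // form_sumr rpred_sum //.
  move=> j _; case: (root_norm (rA j)) => nj; first by rewrite c0 // mul0r rpred0.
  by rewrite rpredM // chi_long.
have := dot_chi c rA; rewrite zE => e.
have := dot_ge0 (c *m A); have := dot_eq0 (c *m A); rewrite e.
have [->|z0] := eqVneq z 0.
  by rewrite mulr0 oppr0 eqxx => /esym/eqP ? _; left.
move=> _ h; right.
have : (z <= -1)%R.
  suff : (z <= 0)%R by lia.
  by rewrite -(ler_int rat); lra.
by rewrite -(ler_int rat) mulrNz; lra.
Qed.

(** Write the root as p - q with disjoint nonnegative supports. As <p, q> <= 0, the norms of p and q
    add up to at most 2. A part free of short rows either vanishes or has norm at least 2, which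
    leaves nothing for the other part; since there is at most one short row, p or q is such a part.
    Positivity of the height excludes p = 0, so q = 0 in all cases. *)
Lemma simple_coef_ge0 k (A : 'M_(k, n)) (c : 'rV_k) : simple_rows A ->
  root (c *m A) -> forall i, 0 <= c 0 i.
Proof.
move=> sA rc; have ci := simple_coef_int sA rc; have [rA tri obt] := sA.
pose cp : 'rV_k := \row_i Num.max (c 0 i) 0.
pose cq : 'rV_k := \row_i Num.max (- c 0 i) 0.
have cpq : c = cp - cq.
  by apply/rowP => i; rewrite !mxE /Num.max; case: ltP => ?; case: ltP => ?; lra.
have cp0 i : 0 <= cp 0 i by rewrite mxE le_max lexx orbT.
have cq0 i : 0 <= cq 0 i by rewrite mxE le_max lexx orbT.
have cpi i : cp 0 i \is a Num.int by rewrite mxE /Num.max; case: ifP.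
have cqi i : cq 0 i \is a Num.int.
  by rewrite mxE /Num.max; case: ifP; rewrite // rpredN.
set p := cp *m A; set q := cq *m A.
have bE : c *m A = p - q by rewrite cpq mulmxBl.
have pq : dot p q <= 0.
  rewrite /dot form_suml sumr_le0 // => i _; rewrite form_sumr mulr_sumr.
  rewrite sumr_le0 // => j _; rewrite mulrA.
  have [<-|ij] := eqVneq i j; last by rewrite mulr_ge0_le0 ?mulr_ge0 ?obt.
  suff -> : cp 0 i * cq 0 i = 0 by rewrite mul0r.
  by rewrite !mxE /Num.max; case: ltP => ?; case: ltP => ?; nra.
have normE : dot (c *m A) (c *m A) = dot p p + dot q q - 2%:R * dot p q.
  by rewrite bE /dot !(formBl, formBr) -/(dot _ _) [form _ q p]dotC /dot; ring.
have heightE (d : 'rV_k) : height (d *m A) = \sum_i d 0 i * height (row i A).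
  rewrite [d *m A]mulmx_sum_row mulmx_suml summxE; apply: eq_bigr => i _.
  by rewrite -scalemxAl mxE.
have height_ge0 (d : 'rV_k) : (forall i, 0 <= d 0 i) -> 0 <= height (d *m A).
  move=> d0; rewrite heightE sumr_ge0 // => i _.
  by rewrite mulr_ge0 // ltW // root_height.
have p_neq0 : p != 0.
  apply/eqP => p0; have := root_height rc; rewrite bE p0 sub0r mulNmx mxE.
  by have := height_ge0 _ cq0; rewrite -/q; lra.
(* A vanishing sum of nonnegative multiples of positive heights has zero coefficients; heights stand
   in for linear independence here. *)
have q0 : q = 0 -> forall i, 0 <= c 0 i.
  move=> q0 i; have : height q = 0 by rewrite q0 mul0mx mxE.
  rewrite heightE => /psumr_eq0P => H.
  have /eqP : cq 0 i * height (row i A) = 0.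
    by apply: H => // j _; rewrite mulr_ge0 // ltW // root_height.
  rewrite mulf_eq0 (gt_eqF (root_height (rA i))) orbF mxE /Num.max.
  by case: ltP => ?; lra.
have bnorm : dot (c *m A) (c *m A) <= 2%:R by case: (root_norm rc); lra.
have [/existsP[i /andP[/eqP ni ci0]]|] :=
    boolP [exists i, (dot (row i A) (row i A) == 1) && (c 0 i < 0)].
  have [|p0|p2] := simple_even_norm rA cpi.
  - move=> j nj; have -> : j = i; last first.
      by rewrite mxE /Num.max; case: ltP => ?; lra.
    apply/eqP; have [//|ij] := eqVneq j i.
    case: (ltngtP i j) => [l|l|/val_inj e]; last by rewrite e eqxx in ij.
      by have := chi_short_neq0 (rA i) (rA j) ni nj; rewrite tri ?eqxx.
    by have := chi_short_neq0 (rA j) (rA i) nj ni; rewrite tri ?eqxx.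
  - by rewrite /p p0 eqxx in p_neq0.
  apply: q0; apply/eqP; rewrite -dot_eq0; apply/eqP.
  by have := dot_ge0 q; move: p2; rewrite -/p; lra.
rewrite negb_exists => /forallP short_ge0.
have [|/q0//|q2] := simple_even_norm rA cqi.
  move=> i ni; have := short_ge0 i; rewrite ni eqxx /= mxE -leNgt /Num.max.
  by case: ltP => ?; lra.
case/eqP: p_neq0; apply/eqP; rewrite -dot_eq0; apply/eqP.
by have := dot_ge0 p; move: q2; rewrite -/q; lra.
Qed.

(** The transition matrices [D] and [C] are nonnegative with D C = 1. If D j i and C i j are both
    nonzero, the zeros in row j of the identity confine row i of [C] to column j, so row i of [A] is
    a positive integral multiple of row j of [B]. A factor of at least 2 would scale the norm by at
    least 4, impossible between the norms 1 and 2. *)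
Lemma simple_rows_sub k k' (A : 'M[rat]_(k, n)) (B : 'M[rat]_(k', n)) :
  simple_rows A -> simple_rows B -> (A :=: B)%MS -> row_free B ->
  forall i, exists j, row i B = row j A.
Proof.
move=> sA sB AB fB j.
have /submxP[D DE] : (B <= A)%MS by rewrite AB.
have /submxP[C CE] : (A <= B)%MS by rewrite AB.
have [rA _ _] := sA; have [rB _ _] := sB.
have rowD i : row i B = row i D *m A by rewrite DE row_mul.
have rowC i : row i A = row i C *m B by rewrite CE row_mul.
have D0 i l : 0 <= D i l.
  by have := @simple_coef_ge0 _ A (row i D) sA; rewrite -rowD => /(_ (rB i) l); rewrite mxE.
have C0 i l : 0 <= C i l.
  by have := @simple_coef_ge0 _ B (row i C) sB; rewrite -rowC => /(_ (rA i) l); rewrite mxE.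
have Cint i l : C i l \is a Num.int.
  by have := @simple_coef_int _ B (row i C) sB; rewrite -rowC => /(_ (rA i) l); rewrite mxE.
have DC : D *m C = 1%:M.
  by apply: (row_free_inj fB); rewrite -mulmxA -CE -DE mul1mx.
have DCE l : \sum_i D j i * C i l = (j == l)%:R.
  by have := congr1 (fun M : 'M_k' => M j l) DC; rewrite !mxE.
have [i Di] : exists i, D j i * C i j != 0.
  apply/existsP; rewrite -negb_forall; apply/negP => /forallP H.
  have := DCE j; rewrite eqxx big1 => [/eqP|i _]; first by rewrite eq_sym oner_eq0.
  by apply/eqP.
exists i.
have [Dn Cn] : D j i != 0 /\ C i j != 0.
  by move: Di; rewrite mulf_eq0 negb_or => /andP[].
have Cil l : l != j -> C i l = 0.
  move=> lj; have := DCE l; rewrite eq_sym (negbTE lj) => /psumr_eq0P H.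
  have /eqP : D j i * C i l = 0 by apply: H => // h _; rewrite mulr_ge0.
  by rewrite mulf_eq0 (negbTE Dn) => /eqP.
have AiE : row i A = C i j *: row j B.
  rewrite rowC mulmx_sum_row (bigD1 j) //= mxE big1 ?addr0 // => l lj.
  by rewrite mxE Cil // scale0r.
have nE : dot (row i A) (row i A) = C i j ^+ 2 * dot (row j B) (row j B).
  by rewrite AiE !dotE mulr_sumr; apply: eq_bigr => l _; rewrite !mxE; ring.
have [m mE] : exists m : nat, C i j = m%:R.
  by apply/natrP; rewrite -intrEge0.
case: m mE => [|[|m]] mE; first by rewrite mE eqxx in Cn.
  by rewrite AiE mE scale1r.
move: nE; rewrite mE -natrX => nE.
have : (4%:R : rat) <= (m.+2 ^ 2)%N%:R by rewrite ler_nat; lia.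
by move=> m4; exfalso; move: nE; case: (root_norm (rA i)) => ->; case: (root_norm (rB j)) => ->; lra.
Qed.

End SimpleSystems.

(** * Spans of roots along reflection words *)

Section ReflectionWords.

Variables (X : finType) (n : nat) (W T : {set {perm X}}).
Variables (rho : {perm X} -> 'M[rat]_n) (rt : {perm X} -> 'rV[rat]_n).
Variable coef : {perm X} -> rat.
Implicit Types (s : seq {perm X}) (t u : {perm X}).

Definition rspan s : 'M[rat]_n := (\sum_(t <- s) <<rt t>>)%MS.

Lemma rspan_cat s1 s2 : rspan (s1 ++ s2) = (rspan s1 + rspan s2)%MS.
Proof. by rewrite /rspan big_cat. Qed.

Lemma rank_rspan s : (\rank (rspan s) <= size s)%N.
Proof.
elim: s => [|t s IH]; first by rewrite /rspan big_nil mxrank0.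
rewrite -cat1s rspan_cat size_cat (leq_trans (mxrank_adds_leqif _ _)) //.
by rewrite leq_add // /rspan big_seq1 genmxE rank_leq_row.
Qed.

Lemma rt_rspan t s : t \in s -> (rt t <= rspan s)%MS.
Proof.
case/splitPr => s1 s2; rewrite -cat1s !rspan_cat.
rewrite (submx_trans _ (addsmxSr _ _)) // (submx_trans _ (addsmxSl _ _)) //.
by rewrite /rspan big_seq1 genmxE.
Qed.

Lemma rspan_free_cat s1 s s2 : \rank (rspan (s1 ++ s ++ s2)) = size (s1 ++ s ++ s2) ->
  \rank (rspan s) = size s.
Proof.
rewrite !rspan_cat !size_cat.
have := mxrank_adds_leqif (rspan s1) (rspan s + rspan s2)%MS.
have := mxrank_adds_leqif (rspan s) (rspan s2).
move=> [h1 _] [h2 _]; have := rank_rspan s1; have := rank_rspan s; have := rank_rspan s2.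
lia.
Qed.

Hypothesis W1 : 1%g \in W.
Hypothesis W_mul : {in W &, forall t u, (t * u)%g \in W}.
Hypothesis TW : T \subset W.
Hypothesis rho1 : rho 1%g = 1%:M.
Hypothesis rhoM : {in W &, forall t u, rho (t * u)%g = rho t *m rho u}.
Hypothesis coef_neq0 : {in T, forall t, coef t != 0}.
Hypothesis rho_refl : {in T, forall t, rho t = 1%:M - coef t *: ((rt t)^T *m rt t)}.

Lemma wprodW s : all (mem T) s -> wprod s \in W.
Proof.
elim: s => [|t s IH] //= /andP[tT /IH sW].
by rewrite wprod_cons W_mul // (subsetP TW).
Qed.

Lemma rho_mulB (U : 'M[rat]_n) w t : w \in W -> t \in W ->
  (rho w - 1%:M <= U)%MS -> (rho t - 1%:M <= U)%MS ->
  (rho (w * t)%g - 1%:M <= U)%MS.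
Proof.
move=> wW tW wU tU.
have -> : rho (w * t)%g - 1%:M = rho w *m (rho t - 1%:M) + (rho w - 1%:M).
  by rewrite rhoM // mulmxBr mulmx1 addrA subrK.
by rewrite addmx_sub // mulmx_sub.
Qed.

(** The easy half of Carter's lemma: each reflection displaces a vector along its own root. *)
Lemma rho_wprod_sub s : all (mem T) s -> (rho (wprod s) - 1%:M <= rspan s)%MS.
Proof.
(* The span stays fixed while the induction runs over words with letters in [s]. *)
move=> sT; suff: forall s' : seq {perm X}, {subset s' <= s} ->
  (rho (wprod s') - 1%:M <= rspan s)%MS by apply.
elim=> [|t s' IH] ss; first by rewrite rho1 subrr sub0mx.
have tT : t \in T by apply: (allP sT); apply: ss; rewrite mem_head.
have ss' : {subset s' <= s} by move=> x xs; apply: ss; rewrite inE xs orbT.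
rewrite wprod_cons rho_mulB ?IH //.
- by apply: wprodW; apply/allP => x /ss' /(allP sT).
- exact: (subsetP TW).
rewrite rho_refl // addrAC subrr sub0r eqmx_opp scalemx_sub // mulmx_sub //.
by apply: rt_rspan; apply: ss; rewrite mem_head.
Qed.

(* The factors to the right of [t] act on [x] first and can only move it along
   their own roots; by independence they all fix [x]. *)
Lemma dot_free_word s1 t s2 (x : 'rV[rat]_n) : all (mem T) (s1 ++ t :: s2) ->
  \rank (rspan (s1 ++ t :: s2)) = size (s1 ++ t :: s2) ->
  x *m (rho (wprod (s1 ++ t :: s2)) - 1%:M) = rt t ->
  forall u, u \in s2 -> dot x (rt u) = 0.
Proof.
elim/last_ind: s2 x => [|s2 v IH] x //.
rewrite -rcons_cons -rcons_cat -cats1; set s := s1 ++ t :: s2.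
rewrite all_cat /= andbT => /andP[sT vT] rk xE.
have fs : \rank (rspan s) = size s.
  by rewrite -[s ++ _]cat0s in rk; apply: rspan_free_cat rk.
have vs : ~~ (rt v <= rspan s)%MS.
  apply/negP => h; move: rk; rewrite rspan_cat size_cat.
  have /eqmxP e : (rspan s + rspan [:: v] == rspan s)%MS.
    by rewrite addsmxSl andbT addsmx_sub submx_refl /rspan big_seq1 genmxE.
  by rewrite e fs /=; lia.
have vW : v \in W by apply: (subsetP TW).
have sW : wprod s \in W by apply: wprodW.
have xv : x *m rho v = x - (coef v * dot x (rt v)) *: rt v.
  rewrite rho_refl // mulmxBr mulmx1 -scalemxAr mulmxA -scalerA.
  rewrite [x *m (rt v)^T]mx11_scalar mul_scalar_mx; congr (_ - _ *: (_ *: _)).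
  by rewrite /dot /form mulmx1.
(* The last letter [v] acts first. Its displacement of [x] is a multiple of [rt v] that the equation
   places in [rspan s], so by [vs] the multiple is zero. *)
have xE' : (coef v * dot x (rt v)) *: rt v =
    x *m rho v *m (rho (wprod s) - 1%:M) - rt t.
  have -> : (coef v * dot x (rt v)) *: rt v = x - x *m rho v.
    by rewrite xv opprB addrC subrK.
  rewrite -xE wprod_cat wprod_cons mul1g rhoM // !mulmxBr !mulmx1 mulmxA opprB.
  by rewrite [RHS]addrC addrA subrK.
have d0 : dot x (rt v) = 0.
  apply/eqP; apply: contraR vs => d0.
  have c0 : coef v * dot x (rt v) != 0 by rewrite mulf_neq0 ?coef_neq0.
  rewrite -(eqmx_scale _ c0) xE' addmx_sub ?eqmx_opp //.
    by rewrite mulmx_sub // rho_wprod_sub.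
  by apply: rt_rspan; rewrite mem_cat mem_head orbT.
move=> u; rewrite mem_rcons inE => /orP[/eqP->//|].
apply: IH => //.
move: xE'; rewrite xv d0 mulr0 scale0r subr0 => /eqP.
by rewrite eq_sym subr_eq0 => /eqP.
Qed.

End ReflectionWords.

(** * Uniqueness of rising factorizations *)

Section RootData.

Variables (X : finType) (n : nat) (W T : {set {perm X}}) (g : {perm X}).
Variables (rho : {perm X} -> 'M[rat]_n) (rt : {perm X} -> 'rV[rat]_n).
Variables (K : 'M[rat]_n) (ht : 'cV[rat]_n).

(* [form K] restricts to the Wall form of [g]: it sends [(alpha, beta)] to
   [<x, beta>], where [x (rho g - 1) = alpha]. *)
Record root_data : Prop := RootData {
  W_one : 1%g \in W;
  W_mul : {in W &, forall t u, (t * u)%g \in W};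
  T_sub : T \subset W;
  T_conj : {in T &, forall t u, (t ^ u)%g \in T};
  T_invol : {in T, forall t, t^-1%g = t};
  rho_one : rho 1%g = 1%:M;
  rho_mul : {in W &, forall t u, rho (t * u)%g = rho t *m rho u};
  rho_T : {in T, forall t,
    rho t = 1%:M - (2%:R / dot (rt t) (rt t)) *: ((rt t)^T *m rt t)};
  g_W : g \in W;
  g_rank : (abs_length T g <= \rank (rho g - 1%:M)%R)%N;
  g_card : (abs_length T g < #|{perm X}|)%N;
  rho_inj : {in W &, injective rho};
  rt_norm : {in T, forall t, dot (rt t) (rt t) = 1 \/ dot (rt t) (rt t) = 2%:R};
  rt_height : {in T, forall t, 0 < (rt t *m ht) 0 0};
  rt_K : {in T, forall t, rt t *m K *m (rho g - 1%:M) = rt t};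
  K_sym : {in T &, forall t u,
    form K (rt t) (rt u) + form K (rt u) (rt t) = - dot (rt t) (rt u)};
  K_long : {in T &, forall t u,
    dot (rt u) (rt u) = 2%:R -> form K (rt t) (rt u) \is a Num.int};
  K_short : {in T &, forall t u,
    dot (rt u) (rt u) = 1 -> 2%:R * form K (rt t) (rt u) \is a Num.int};
  K_short_neq0 : {in T &, forall t u, dot (rt t) (rt t) = 1 ->
    dot (rt u) (rt u) = 1 -> form K (rt t) (rt u) != 0}
}.

Variable lt : rel {perm X}.
Hypothesis data : root_data.
Hypothesis lt_total : strict_total_order_on T lt.
Hypothesis lt_obtuse : {in T &, forall t u, lt t u ->
  form K (rt t) (rt u) = 0 -> dot (rt t) (rt u) <= 0}.
Implicit Types (s : seq {perm X}) (t u : {perm X}).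

Definition isroot (x : 'rV[rat]_n) : Prop := exists2 t, t \in T & x = rt t.

Let lt_trans : {in T & &, transitive lt}.
Proof. by move=> y x z yT xT zT; have [_ ltT _] := lt_total; apply: ltT. Qed.

Let rt_inj : {in T &, injective rt}.
Proof.
move=> t u tT uT e; apply: (rho_inj data); rewrite ?(subsetP (T_sub data)) //.
by rewrite !(rho_T data) // e.
Qed.

Let root_chi_sym x y : isroot x -> isroot y ->
  form K x y + form K y x = - dot x y.
Proof. by move=> [t tT ->] [u uT ->]; apply: (K_sym data). Qed.

Let root_dot x : isroot x -> dot x x = 1 \/ dot x x = 2%:R.
Proof. by move=> [t tT ->]; apply: (rt_norm data). Qed.

Let root_ht x : isroot x -> 0 < (x *m ht) 0 0.
Proof. by move=> [t tT ->]; apply: (rt_height data). Qed.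

Let root_chi_long x y : isroot x -> isroot y -> dot y y = 2%:R ->
  form K x y \is a Num.int.
Proof. by move=> [t tT ->] [u uT ->]; apply: (K_long data). Qed.

Let root_chi_short x y : isroot x -> isroot y -> dot y y = 1 ->
  2%:R * form K x y \is a Num.int.
Proof. by move=> [t tT ->] [u uT ->]; apply: (K_short data). Qed.

Let root_chi_neq0 x y : isroot x -> isroot y -> dot x x = 1 -> dot y y = 1 ->
  form K x y != 0.
Proof. by move=> [t tT ->] [u uT ->]; apply: (K_short_neq0 data). Qed.

Let coef t : rat := 2%:R / dot (rt t) (rt t).

Let coef_neq0 : {in T, forall t, coef t != 0}.
Proof. by move=> t tT; rewrite /coef; case: (rt_norm data tT) => ->. Qed.

(** The size of the word is the length of [g], hence at most the rank of [rho g - 1], whose image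
    lies in the span of the roots: that span has the largest possible rank. *)
Let free_word s : reduced T g s -> \rank (rspan rt s) = size s.
Proof.
case/and3P=> sT /eqP gE /eqP sz; apply/eqP; rewrite eqn_leq rank_rspan sz.
rewrite (leq_trans (g_rank data)) // -gE mxrankS //.
exact: (rho_wprod_sub (W_one data) (W_mul data) (T_sub data) (rho_one data)
          (rho_mul data) (rho_T data)).
Qed.

(** The vector [rt t *m K] is a preimage of [rt t] under [rho g - 1], as [dot_free_word] requires,
    and its dot product with a root is the form. *)
Let chi_word s i j : reduced T g s -> (i < j < size s)%N ->
  form K (rt (nth 1%g s i)) (rt (nth 1%g s j)) = 0.
Proof.
move=> rs /andP[ij js]; have /and3P[sT /eqP gE _] := rs.
have is_ := ltn_trans ij js.
have sE : take i s ++ nth 1%g s i :: drop i.+1 s = s.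
  by rewrite -drop_nth // cat_take_drop.
have tT : nth 1%g s i \in T by apply: (allP sT); rewrite mem_nth.
have := dot_free_word (W_one data) (W_mul data) (T_sub data) (rho_one data)
          (rho_mul data) coef_neq0 (rho_T data) (s1 := take i s) (t := nth 1%g s i)
          (s2 := drop i.+1 s) (x := rt (nth 1%g s i) *m K).
rewrite sE gE => /(_ sT (free_word rs) (rt_K data tT)) H.
have /H : nth 1%g s j \in drop i.+1 s.
  have -> : j = (i.+1 + (j - i.+1))%N by rewrite subnKC.
  by rewrite -nth_drop mem_nth // size_drop ltn_sub2r // (leq_ltn_trans ij).
by rewrite /dot /form mulmx1.
Qed.

Definition rtmx s := \matrix_(i < size s) rt (nth 1%g s i).

Let rtmx_rspan s : (rtmx s :=: rspan rt s)%MS.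
Proof.
apply/eqmxP/andP; split.
  by apply/row_subP => i; rewrite rowK rt_rspan // mem_nth.
rewrite /rspan big_tnth; apply/sumsmx_subP => i _; rewrite genmxE.
rewrite (tnth_nth 1%g) /=.
by have := row_sub i (rtmx s); rewrite rowK.
Qed.

Let simple_word s1 s s2 : reduced T g (s1 ++ s ++ s2) -> sorted lt s ->
  simple_rows K isroot (rtmx s).
Proof.
move=> rs ss; have /and3P[] := rs; rewrite !all_cat => /and3P[_ sT _] _ _.
have nT i : (i < size s)%N -> nth 1%g s i \in T.
  by move=> il; apply: (allP sT); rewrite mem_nth.
have tri i j : (i < j < size s)%N -> form K (rt (nth 1%g s i)) (rt (nth 1%g s j)) = 0.
  move=> /andP[ij js]; have is_ := ltn_trans ij js.
  have := @chi_word _ (size s1 + i) (size s1 + j) rs.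
  rewrite !nth_cat !size_cat !ltnNge !leq_addr /= -!ltnNge !addKn is_ js.
  by apply; rewrite ltn_add2l ij ltn_add2l ltn_addr.
have obt i j : (i < j < size s)%N -> dot (rt (nth 1%g s i)) (rt (nth 1%g s j)) <= 0.
  move=> ijs; have /andP[ij js] := ijs; have is_ := ltn_trans ij js.
  apply: lt_obtuse; rewrite ?nT ?tri //.
  exact: (sorted_ltn_nth_in lt_trans 1%g sT ss).
split=> [i|i j ij|i j ij]; rewrite ?rowK.
- by exists (nth 1%g s i); rewrite ?nT.
- by rewrite tri // ij ltn_ord.
case: (ltngtP i j) => [l|l|/val_inj e]; last by rewrite e eqxx in ij.
  by rewrite obt // l ltn_ord.
by rewrite dotC obt // l ltn_ord.
Qed.

(** Here the span of the roots becomes a function of the product of the word alone, which makes two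
    rising words for the same element comparable. *)
Let span_word s1 s s2 : reduced T g (s1 ++ s ++ s2) ->
  (rtmx s :=: rho (wprod s) - 1%:M)%MS.
Proof.
move=> rs; have fs := rspan_free_cat (free_word rs).
have /and3P[] := rs; rewrite !all_cat => /and3P[s1T sT s2T] /eqP gE /eqP sz.
have sub := rho_wprod_sub (W_one data) (W_mul data) (T_sub data) (rho_one data)
          (rho_mul data) (rho_T data).
have inW := wprodW (W_one data) (W_mul data) (T_sub data).
apply: (eqmx_trans (@rtmx_rspan s)); apply/eqmx_sym/eqmxP.
rewrite -(mxrank_leqif_eq (sub _ sT)).
rewrite eqn_leq mxrankS ?sub //= fs.
have := g_rank data; rewrite -sz -gE !wprod_cat !size_cat.
(* In [U] the image of [rho (wprod s) - 1] replaces the span of the roots of [s]. It still contains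
   the image of [rho g - 1], so the replacement cannot lower the rank. *)
set U := (rspan rt s2 + (rho (wprod s) - 1%:M) + rspan rt s1)%MS.
have : (rho (wprod s2 * wprod s * wprod s1)%g - 1%:M <= U)%MS.
  have mulB := rho_mulB (rho_mul data).
  rewrite mulB ?inW ?(W_mul data) ?inW //.
    rewrite mulB ?inW // /U -addsmxA.
      by rewrite (submx_trans (sub _ s2T)) // addsmxSl.
    by rewrite (submx_trans _ (addsmxSr _ _)) // addsmxSl.
  by rewrite (submx_trans (sub _ s1T)) // /U addsmxSr.
move/mxrankS.
have [h1 _] := mxrank_adds_leqif (rspan rt s2 + (rho (wprod s) - 1%:M))%MS (rspan rt s1).
have [h2 _] := mxrank_adds_leqif (rspan rt s2) (rho (wprod s) - 1%:M)%MS.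
have := rank_rspan rt s1; have := rank_rspan rt s2.
rewrite -/U in h1; lia.
Qed.

Lemma rising_unique s1 s s' s2 :
  reduced T g (s1 ++ s ++ s2) -> reduced T g (s1 ++ s' ++ s2) ->
  wprod s = wprod s' -> sorted lt s -> sorted lt s' -> s = s'.
Proof.
move=> rs rs' wE ss ss'.
have [ltI _ _] := lt_total.
have /and3P[] := rs; rewrite !all_cat => /and3P[_ sT _] _ /eqP sz.
have /and3P[] := rs'; rewrite !all_cat => /and3P[_ sT' _] _ /eqP sz'.
have es : size s' = size s by move: sz sz'; rewrite !size_cat; lia.
have sA := simple_word rs ss; have sB := simple_word rs' ss'.
have fB : row_free (rtmx s').
  by rewrite /row_free rtmx_rspan (rspan_free_cat (free_word rs')).
have AB : (rtmx s :=: rtmx s')%MS.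
  by apply: (eqmx_trans (span_word rs)); rewrite wE; apply/eqmx_sym/span_word/rs'.
have sub : {subset s' <= s}.
  move=> t /(nthP 1%g)[i il <-].
  have [j] := simple_rows_sub root_chi_sym root_dot root_chi_long root_chi_short
    root_chi_neq0 root_ht sA sB AB fB (Ordinal il).
  rewrite !rowK /= => /rt_inj.
  move=> ->; rewrite ?mem_nth //.
  - by apply: (allP sT'); rewrite mem_nth.
  - by apply: (allP sT); rewrite mem_nth.
have us : uniq s'.
  apply: (sorted_uniq_in _ _ ss') => [x y z /(allP sT') ? /(allP sT') ? /(allP sT') ?|x /(allP sT') xT].
    exact: lt_trans.
  by apply/negbTE/ltI.
have [_ e] := uniq_min_size us sub (eq_leq (esym es)).
apply/esym; apply: (irr_sorted_eq_in _ _ ss' ss) => //.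
  by move=> x y z /(allP sT') ? /(allP sT') ? /(allP sT') ?; exact: lt_trans.
by move=> x /(allP sT') xT; apply/negbTE/ltI.
Qed.

Theorem EL_labeling_of_root_data : EL_labeling T lt (@natural_label _ W T g).
Proof.
apply: EL_labeling_of_rising_unique => //.
- exact: W_one data.
- by move=> t w tT wW; apply: (W_mul data) => //; apply: (subsetP (T_sub data)).
- exact: g_W data.
- exact: g_card data.
- exact: T_conj data.
- exact: T_invol data.
- exact: rising_unique.
Qed.

End RootData.

(** * Type A *)

Section Cycles.

Variable X : finType.
Implicit Types (r : seq X).

Lemma cyc_nth r (d : X) i : uniq r -> (i < size r)%N ->
  cyc r (nth d r i) = nth d r (i.+1 %% size r).
Proof.
move=> ur ir; rewrite permE next_nth undup_id // mem_nth // index_uniq //.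
case: r ur ir => // y r ur; rewrite /= ltnS leq_eqVlt => /orP[/eqP->|ir].
  by rewrite modnn nth_default.
by rewrite modn_small //=; apply: set_nth_default.
Qed.

Lemma cyc_out r (x : X) : x \notin r -> cyc r x = x.
Proof. by move=> xr; rewrite permE next_nth mem_undup (negbTE xr). Qed.

Lemma cyc2 (x y : X) : x != y -> cyc [:: x; y] = tperm x y.
Proof.
move=> xy; apply/permP => z; rewrite permE undup_id /= ?inE ?xy //.
by rewrite [RHS]permE /=.
Qed.

End Cycles.

(** * Cycles on an initial segment of indices *)

Section Successor.

Variables (n p : nat) (r : seq 'I_n).
Hypothesis rE : map val r = iota 0 p.

Lemma uniq_iota_ord : uniq r.
Proof. by rewrite -(map_inj_uniq val_inj) rE iota_uniq. Qed.

Lemma size_iota_ord : size r = p.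
Proof. by rewrite -(size_map val) rE size_iota. Qed.

Lemma mem_iota_ord i : (i \in r) = (i < p)%N.
Proof. by rewrite -(mem_map val_inj) rE mem_iota. Qed.

Lemma index_iota_ord i : index i r = minn i p.
Proof.
rewrite -(index_map val_inj) rE; case: (ltnP i p) => ip.
  have {1}-> : val i = nth 0%N (iota 0 p) i by rewrite nth_iota.
  by rewrite index_uniq ?iota_uniq ?size_iota //; lia.
by rewrite memNindex ?mem_iota ?size_iota //=; lia.
Qed.

(** Applied with p = n in types A and B and with p = n - 1 in type D. *)
Lemma cyc_iota_ord i :
  cyc r i = (if (i < p)%N then (i.+1 %% p)%N else i) :> nat.
Proof.
case: ltnP => ip; last by rewrite cyc_out // mem_iota_ord -leqNgt.
have iE : i = nth i r i.
  by apply: val_inj; rewrite -(nth_map _ 0%N) ?size_iota_ord // rE nth_iota.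
rewrite {1}iE cyc_nth ?uniq_iota_ord ?size_iota_ord //.
rewrite -(nth_map _ 0%N val) ?size_iota_ord ?ltn_mod; last by lia.
by rewrite rE nth_iota // ltn_mod; lia.
Qed.

End Successor.

Lemma map_val_enum_ord n : map val (enum 'I_n) = iota 0 n.
Proof. exact: val_enum_ord. Qed.

Lemma map_val_enum_ord_lt n p : (p <= n)%N ->
  map val [seq i : 'I_n <- enum 'I_n | (i < p)%N] = iota 0 p.
Proof.
move=> pn; rewrite -(filter_map val (fun i => i < p)%N) val_enum_ord.
by have := filter_iota_ltn 0 pn; rewrite add0n.
Qed.

(** * Reflection length of permutations *)

Section TranspositionLength.

Variable n : nat.

Lemma tperm_TA (i j : 'I_n) : i != j -> tperm i j \in TA n.
Proof.
rewrite neq_ltn inE => /orP[ij|ji]; apply/existsP.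
  by exists i; apply/existsP; exists j; rewrite ij eqxx.
by exists j; apply/existsP; exists i; rewrite ji tpermC eqxx.
Qed.

(** One transposition fixes the smallest point that moves, and this is repeated upwards. When only
    the point p - 1 could still move, nothing moves, which saves the last transposition. *)
Lemma abs_length_TA p (w : {perm 'I_n}) : (forall i : 'I_n, (p <= i)%N -> w i = i) ->
  (abs_length (TA n) w <= p.-1)%N.
Proof.
move=> wp; suff H m : (forall i : 'I_n, (i < p.-1 - m)%N -> w i = i) ->
    (abs_length (TA n) w <= m)%N.
  by apply: H => i; rewrite subnn.
elim: m w wp => [|m IH] w wp wm.
  suff -> : w = 1%g by rewrite abs_length1.
  have fix_ne (i : 'I_n) : (i : nat) != p.-1 -> w i = i.
    by move=> ip; case: (leqP p i) => [/wp//|ltip]; apply: wm; lia.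
  apply/permP => i; rewrite perm1; have [ip|/fix_ne//] := eqVneq (i : nat) p.-1.
  have [//|wi] := eqVneq (w i) i.
  have /fix_ne/perm_inj//: (w i : nat) != p.-1.
  by rewrite -ip (inj_eq val_inj).
have [pm|pm] := leqP p.-1 m; first by apply: (leq_trans (IH w wp _)) => // i; lia.
have [np|np] := leqP n (p.-1 - m.+1).
  by apply: leq_trans (IH w wp _) _ => // i _; apply: wm; have := ltn_ord i; lia.
pose i0 := Ordinal np.
have [wi0|wi0] := eqVneq (w i0) i0.
  apply: leq_trans (IH w wp _) _ => // i im.
  have [->//|ii0] := eqVneq i i0; apply: wm.
  by move: ii0; rewrite -val_eqE /=; lia.
have fix_t (i : 'I_n) : w i = i -> i != i0 -> (w * tperm i0 (w i0))%g i = i.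
  move=> wi ii0; rewrite permM wi tpermD // 1?eq_sym //.
  by apply: contra ii0 => /eqP e; apply/eqP/(@perm_inj _ w); rewrite wi.
have t1 := abs_lengthP (_ : tperm i0 (w i0) \in TA n ^+ 1)%g.
have wE : w = (w * tperm i0 (w i0) * tperm i0 (w i0))%g by rewrite -mulgA tperm2 mulg1.
rewrite wE (leq_trans (abs_lengthM _ _ _)) // -addn1 leq_add //.
  apply: IH => [i ip|i im].
    by apply: fix_t; [apply: wp | rewrite -val_eqE /=; lia].
  have [->|ii0] := eqVneq i i0; first by rewrite permM tpermR.
  by apply: fix_t => //; apply: wm; move: ii0; rewrite -val_eqE /=; lia.
by apply: t1; rewrite expg1 tperm_TA // eq_sym.
Qed.

End TranspositionLength.

(** * Choosing the root of a reflection *)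

Section RootOf.

Variables (I : finType) (U : eqType) (V : zmodType).
Variables (ok : pred I) (refl : I -> U) (vec : I -> V).

(** The root is read off whichever presentation [pick] returns, so that a reflection never has to be
    shown to determine its indices; 0 is the value outside the reflections. *)
Definition root_of (t : U) : V :=
  if [pick p | ok p && (refl p == t)] is Some p then vec p else 0.

Lemma root_ofP t : (exists2 p, ok p & t = refl p) ->
  exists p, [/\ ok p, t = refl p & root_of t = vec p].
Proof.
move=> [p okp tE]; rewrite /root_of; case: pickP => [q /andP[okq /eqP qt]|/(_ p)].
  by exists q.
by rewrite okp tE eqxx.
Qed.

End RootOf.

Lemma form_delta n (K : 'M[rat]_n) i j : form K (delta_mx 0 i) (delta_mx 0 j) = K i j.
Proof. by rewrite /form -rowE trmx_delta -colE !mxE. Qed.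

Lemma dot_delta n (i j : 'I_n) : dot (delta_mx 0 i) (delta_mx 0 j) = (i == j)%:R.
Proof. by rewrite /dot form_delta mxE. Qed.

Lemma reflection_mx n (A : 'M[rat]_n) c v :
  (forall i, row i A = delta_mx 0 i - (c * dot (delta_mx 0 i) v) *: v) ->
  A = 1%:M - c *: (v^T *m v).
Proof.
move=> H; apply/row_matrixP => i; rewrite H [in RHS]rowE mulmxBr mulmx1 -scalemxAr.
rewrite mulmxA [_ *m v^T]mx11_scalar mul_scalar_mx scalerA.
by rewrite /dot /form mulmx1.
Qed.

(** * The Wall form of the n-cycle *)

Section TypeA.

Variable n : nat.
Hypothesis n_gt1 : (1 < n)%N.

Notation e i := (delta_mx 0 i : 'rV[rat]_n).

Definition rootA : {perm 'I_n} -> 'rV[rat]_n :=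
  root_of (fun p : 'I_n * 'I_n => (p.1 < p.2)%N) (fun p => tperm p.1 p.2)
    (fun p => e p.1 - e p.2).

Lemma rootA_P t : t \in TA n ->
  exists i j : 'I_n, [/\ (i < j)%N, t = tperm i j & rootA t = e i - e j].
Proof.
rewrite inE => /existsP[i /existsP[j /andP[ij /eqP tE]]].
have [|[k l] [kl tE' rE]] := @root_ofP _ _ 'rV[rat]_n (fun p : 'I_n * 'I_n => (p.1 < p.2)%N)
   (fun p => tperm p.1 p.2) (fun p => e p.1 - e p.2) t.
  by exists (i, j).
by exists k, l.
Qed.

(* Up to a constant summand, which vanishes on roots since their coordinates sum
   to 0, the types A and B use the same form. *)
Definition KA : 'M[rat]_n := \matrix_(i, j) - (i <= j)%N%:R.
Definition htA : 'cV[rat]_n := \col_i (n - i)%:R.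

Lemma formA i j k l : form KA (e i - e j) (e k - e l) =
  (i <= l)%N%:R + (j <= k)%N%:R - (i <= k)%N%:R - (j <= l)%N%:R.
Proof. by rewrite !(formBl, formBr) !form_delta !mxE; ring. Qed.

Lemma dotA (i j k l : 'I_n) : dot (e i - e j) (e k - e l) =
  (i == k)%:R + (j == l)%:R - (i == l)%:R - (j == k)%:R.
Proof. by rewrite /dot !(formBl, formBr) !form_delta !mxE; ring. Qed.

Lemma coxA_val (i : 'I_n) : coxA n i = (i.+1 %% n)%N :> nat.
Proof. by rewrite (cyc_iota_ord (map_val_enum_ord n)) ltn_ord. Qed.

(** The n-cycle fixes the all-ones vector, so an error term of rank one is unavoidable. Its column
    [c] is constant and hence annihilated by every root, and its rank costs just one in the bound
    for the rank of gamma - 1. *)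
Lemma KA_inv : exists2 c : 'cV[rat]_n,
  KA *m (perm_mx (coxA n) - 1%:M) = 1%:M - c *m e (Ordinal (ltnW n_gt1)) &
  forall i, c i 0 = 1.
Proof.
exists (const_mx 1) => [|i]; last by rewrite mxE.
rewrite mulmxBr mulmx1; apply/matrixP => i j.
(* Columns are named by their preimages under gamma, so that the permutation matrix merely renames
   them; the wrap-around is the case k = n - 1. *)
have [k ->] : exists k, j = coxA n k by exists ((coxA n)^-1%g j); rewrite permKV.
have -> : KA *m perm_mx (coxA n) = col_perm (coxA n)^-1%g KA.
  by rewrite col_permE invgK.
rewrite !mxE permK big_ord1 !mxE eqxx -!val_eqE /= coxA_val.
have := ltn_ord k; rewrite leq_eqVlt => /orP[/eqP kn|kn].
  rewrite kn modnn; have := ltn_ord i; have -> : (k : nat) = n.-1 by lia.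
  move=> il; have -> : (i <= n.-1)%N by lia.
  by rewrite leqn0 eqxx; case: (_ == _); rewrite ?(mulr0n, mulr1n); lra.
rewrite modn_small //; have [l|l|->] := ltngtP (i : nat) k.+1.
- by have -> : (i <= k)%N by lia; rewrite ?(mulr0n, mulr1n); lra.
- by have -> : (i <= k)%N = false by lia; rewrite ?(mulr0n, mulr1n); lra.
by rewrite ltnn ?(mulr0n, mulr1n); lra.
Qed.

Lemma root_dataA : root_data (WA n) (TA n) (coxA n)
  (@perm_mx rat n) rootA KA htA.
Proof.
have [c KE cE] := KA_inv.
have card_gt k : (k < n)%N -> (k < #|{perm 'I_n}|)%N.
  by rewrite card_Sn => /leq_trans; apply; apply: fact_geq.
have len : (abs_length (TA n) (coxA n) <= n.-1)%N.
  by apply: abs_length_TA => i; have := ltn_ord i; lia.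
have TAtperm t : t \in TA n -> exists i j : 'I_n, i != j /\ t = tperm i j.
  by move=> /rootA_P[i [j [ij -> _]]]; exists i, j; rewrite -val_eqE /= ltn_eqF.
split.
- by rewrite inE.
- by move=> *; rewrite inE.
- by apply/subsetP => t _; rewrite inE.
- move=> t u /TAtperm[i [j [ij ->]]] _; rewrite tpermJ tperm_TA //.
  by rewrite (inj_eq perm_inj).
- by move=> t /TAtperm[i [j [_ ->]]]; rewrite tpermV.
- exact: perm_mx1.
- by move=> t u _ _; rewrite perm_mxM.
- move=> t /rootA_P[i [j [ij -> ->]]]; apply: reflection_mx => k.
  have ij' : i != j by rewrite -val_eqE /= ltn_eqF.
  have -> : row k (perm_mx (tperm i j)) = e (tperm i j k).
    by apply/rowP => l; rewrite !mxE eqxx eq_sym.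
  rewrite dotA !eqxx (negbTE ij') [j == i]eq_sym (negbTE ij').
  have -> : 2%:R / (true%:R + true%:R - false%:R - false%:R) = 1 :> rat by [].
  rewrite /dot formBr -!/(dot _ _) !dot_delta mul1r.
  case: tpermP => [->|->|/eqP ki /eqP kj].
  + by rewrite eqxx (negbTE ij') subr0 scale1r opprB addrC subrK.
  + by rewrite eqxx eq_sym (negbTE ij') sub0r scaleN1r opprK addrC subrK.
  by rewrite (negbTE ki) (negbTE kj) subrr scale0r subr0.
- by rewrite inE.
(* The identity is [KA *m (perm_mx (coxA n) - 1)] plus a product through dimension one, so gamma - 1
   has rank at least n - 1. *)
- apply: (leq_trans len).
  have := mxrankM_maxr KA (perm_mx (coxA n) - 1%:M); rewrite KE => /(leq_trans _); apply.
  have := leq_trans (mxrank_add _ _) (leq_add (leqnn _) (mulmx_max_rank c (e (Ordinal (ltnW n_gt1))))).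
  by move/(_ (1%:M - c *m e (Ordinal (ltnW n_gt1)))); rewrite subrK mxrank1; lia.
- by apply: card_gt; lia.
- move=> t u _ _ tu; apply/permP => i; apply/eqP.
  have := congr1 (fun M : 'M[rat]_n => M i (t i)) tu; rewrite !mxE eqxx eq_sym.
  by case: eqP => // _ /eqP; rewrite oner_eq0.
- move=> t /rootA_P[i [j [ij _ ->]]]; right.
  have ij' : i != j by rewrite -val_eqE /= ltn_eqF.
  by rewrite dotA !eqxx (negbTE ij') [j == i]eq_sym (negbTE ij') ?(mulr0n, mulr1n); lra.
- move=> t /rootA_P[i [j [ij _ ->]]].
  rewrite mulmxBl -!rowE !mxE subr_gt0 ltr_nat; have := ltn_ord j; lia.
- move=> t /rootA_P[i [j [ij _ ->]]].
  rewrite -mulmxA KE mulmxBr mulmx1 mulmxA mulmxBl -!rowE.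
  suff -> : row i c - row j c = 0 by rewrite mul0mx subr0.
  by apply/rowP => k; rewrite !mxE !ord1 !cE subrr.
- move=> t u /rootA_P[i [j [ij _ ->]]] /rootA_P[k [l [kl _ ->]]].
  rewrite !formA dotA -!val_eqE /=.
  case: (ltngtP i k) => ?; case: (ltngtP i l) => ?; case: (ltngtP j k) => ?;
    case: (ltngtP j l) => ?; rewrite ?(mulr0n, mulr1n); first [lra | lia].
- move=> t u /rootA_P[i [j [ij _ ->]]] /rootA_P[k [l [kl _ ->]]] _.
  by rewrite formA !rpredB ?rpredD ?rpred_nat.
- move=> t u /rootA_P[i [j [ij _ ->]]] /rootA_P[k [l [kl _ ->]]] _.
  by rewrite rpredM ?formA ?rpredB ?rpredD ?rpred_nat.
move=> t u /rootA_P[i [j [ij _ ->]]] _ d1 _; exfalso; move: d1.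
have ij' : i != j by rewrite -val_eqE /= ltn_eqF.
by rewrite dotA !eqxx (negbTE ij') [j == i]eq_sym (negbTE ij') ?(mulr0n, mulr1n); lra.
Qed.

(** An acute pair of distinct roots shares its smaller or its larger index. In both cases chi
    vanishes only when the remaining indices are in the order for which compatibility puts [u]
    before [t]. *)
Lemma obtuseA (lt : rel {perm 'I_n}) :
  strict_total_order_on (TA n) lt -> compatibleA lt ->
  {in TA n &, forall t u, lt t u -> form KA (rootA t) (rootA u) = 0 ->
    dot (rootA t) (rootA u) <= 0}.
Proof.
move=> [ltI ltT _] comp t u tT uT tu.
have asym : ~~ lt u t.
  by apply/negP => ut; have := ltI _ tT; rewrite (ltT _ _ _ tT uT tT tu ut).
move: asym tu (ltI _ tT); have /rootA_P[i [j [ij tE ->]]] := tT.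
have /rootA_P[k [l [kl uE ->]]] := uT; rewrite {}tE {}uE {tT uT}.
rewrite formA dotA => asym lt_tu irr.
have [eik|nik] := eqVneq i k; have [ejl|njl] := eqVneq j l.
- by move: lt_tu irr; rewrite eik ejl => ->.
- subst k; have [lj|jl] := ltnP l j.
    have /comp[h _] : (i < l < j)%N by lia.
    by rewrite h in asym.
  have [-> -> ->] : [/\ (i <= l)%N, (j <= i)%N = false & (i <= i)%N] by split; lia.
  by rewrite ?jl ?(mulr0n, mulr1n); lra.
- subst l; have [ki|ik] := ltnP k i.
    have /comp[_ h] : (k < i < j)%N by lia.
    by rewrite h in asym.
  have [-> -> ->] : [/\ (i <= j)%N, (j <= k)%N = false & (j <= j)%N] by split; lia.
  by rewrite ?ik ?(mulr0n, mulr1n); lra.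
by case: (_ == _); case: (_ == _); rewrite ?(mulr0n, mulr1n); lra.
Qed.

Theorem EL_labelingA lt :
  strict_total_order_on (TA n) lt -> compatibleA lt ->
  EL_labeling (TA n) lt (@natural_label _ (WA n) (TA n) (coxA n)).
Proof.
by move=> tot comp; apply: (EL_labeling_of_root_data root_dataA tot); apply: obtuseA.
Qed.
End TypeA.

(** * Signed permutations *)

Local Notation opp := (@Defs.opp _).

Section SignedPermutations.

Variable n : nat.
Implicit Types (x y z : letter n) (u v w : {perm letter n}).

Lemma opp_involutive : involutive (@Defs.opp n).
Proof. by case=> i b; rewrite /opp negbK. Qed.

Lemma WBE w x : w \in WB n -> w (opp x) = opp (w x).
Proof. by rewrite inE => /forallP/(_ x)/eqP. Qed.

Lemma WB1 : 1%g \in WB n.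
Proof. by rewrite inE; apply/forallP => x; rewrite !perm1. Qed.

Lemma WBM : {in WB n &, forall u v, (u * v)%g \in WB n}.
Proof.
move=> u v uW vW; rewrite inE; apply/forallP => x.
by rewrite !permM !WBE.
Qed.

Definition evec x : 'rV[rat]_n := (-1) ^+ x.2 *: delta_mx 0 x.1.

Lemma evec_opp x : evec (opp x) = - evec x.
Proof. by case: x => i []; rewrite /evec /= ?expr0 expr1 ?scaleN1r ?scale1r ?opprK. Qed.

Lemma evec_pos (i : 'I_n) : evec (pos i) = delta_mx 0 i.
Proof. by rewrite /evec expr0 scale1r. Qed.

Lemma evec_inj : injective evec.
Proof.
move=> [i b] [j c] /rowP e; have := e i; have := e j.
rewrite !mxE !eqxx /= [j == i]eq_sym; have [->|ij] := eqVneq i j.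
  rewrite !mulr1; case: b e; case: c => //=; rewrite ?expr0 ?expr1 => _; lra.
by rewrite mulr0 mulr1 => /eqP; rewrite eq_sym signr_eq0.
Qed.

Definition srho w : 'M[rat]_n := \matrix_i evec (w (pos i)).

Lemma evec_srho w x : w \in WB n -> evec x *m srho w = evec (w x).
Proof.
move=> wW; have evec_posE (i : 'I_n) : evec (pos i) *m srho w = evec (w (pos i)).
  by rewrite evec_pos -rowE rowK.
case: x => i []; last exact: evec_posE.
by rewrite -[(i, true)]/(opp (pos i)) WBE // !evec_opp mulNmx evec_posE.
Qed.

Lemma srho1 : srho 1%g = 1%:M.
Proof. by apply/row_matrixP => i; rewrite rowK perm1 evec_pos row1. Qed.

Lemma srhoM : {in WB n &, forall u v, srho (u * v)%g = srho u *m srho v}.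
Proof.
move=> u v uW vW; apply/row_matrixP => i.
by rewrite row_mul !rowK permM evec_srho.
Qed.

Lemma srho_inj : {in WB n &, injective srho}.
Proof.
move=> u v uW vW uv; apply/permP => x; apply: evec_inj.
by rewrite -!evec_srho // uv.
Qed.

Lemma refl2E x y : x.1 != y.1 ->
  refl2 x y = (tperm (opp x) (opp y) * tperm x y)%g.
Proof.
move=> xy; have xy' : x != y by apply: contra xy => /eqP->.
rewrite /refl2 /pcyc /perm_comp !cyc2 //.
by apply: contra xy => /eqP/(can_inj opp_involutive)->.
Qed.

Lemma refl2_val x y z : x.1 != y.1 -> refl2 x y z =
  if z == x then y else if z == y then x else
  if z == opp x then opp y else if z == opp y then opp x else z.
Proof.
move=> xy; rewrite refl2E // permM.
case: x y z xy => i b [j c] [k d] /= ij; rewrite !(permE, xpair_eqE) /= !xpair_eqE /=.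
have ji : (j == i) = false by rewrite eq_sym (negbTE ij).
have [->|ki] := eqVneq k i; rewrite ?(negbTE ij) ?eqxx /=.
  by case: b c d => [] [] []; rewrite /= ?xpair_eqE ?eqxx ?ji ?(negbTE ij) /= ?xpair_eqE ?eqxx ?ji ?(negbTE ij).
have [->|kj] := eqVneq k j; rewrite ?ji ?eqxx /=.
  by case: b c d => [] [] []; rewrite /= ?xpair_eqE ?eqxx ?ji ?(negbTE ij) /= ?xpair_eqE ?eqxx ?ji ?(negbTE ij).
by rewrite xpair_eqE (negbTE ki) /= xpair_eqE (negbTE kj).
Qed.

Lemma refl2_WB x y : x.1 != y.1 -> refl2 x y \in WB n.
Proof.
move=> xy; rewrite inE; apply/forallP => z; apply/eqP; rewrite !refl2_val //.
case: x y z xy => i b [j c] [k d] /= ij; rewrite /Defs.opp !xpair_eqE /=.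
have ji : (j == i) = false by rewrite eq_sym (negbTE ij).
have [->|ki] := eqVneq k i; rewrite ?(negbTE ij) ?eqxx /=.
  by case: b c d => [] [] [].
have [->|kj] := eqVneq k j; rewrite ?ji ?eqxx //=.
by case: b c d => [] [] [].
Qed.

Lemma form_evec K x y :
  form K (evec x) (evec y) = (-1) ^+ x.2 * (-1) ^+ y.2 * K x.1 y.1.
Proof.
rewrite -form_delta /form /evec linearZ /= -scalemxAr -!scalemxAl scalerA.
by rewrite mxE mulrC [in RHS]mulrC [_ ^+ y.2 * _]mulrC.
Qed.

Lemma dot_evec x y :
  dot (evec x) (evec y) = (-1) ^+ x.2 * (-1) ^+ y.2 * (x.1 == y.1)%:R.
Proof. by rewrite /dot form_evec mxE. Qed.

Lemma srho_refl2 x y : x.1 != y.1 ->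
  srho (refl2 x y) = 1%:M - (evec x - evec y)^T *m (evec x - evec y).
Proof.
move=> xy; rewrite -[X in 1%:M - X]scale1r; apply: reflection_mx => k.
rewrite rowK -evec_pos mul1r; set z := pos k.
rewrite refl2_val // /dot formBr -!/(dot _ _) !dot_evec.
have [->|zx] := eqVneq z x.
  rewrite eqxx (negbTE xy) mulr0 subr0 mulr1 -expr2 sqrr_sign scale1r.
  by rewrite opprB addrC subrK.
have [->|zy] := eqVneq z y.
  rewrite eqxx eq_sym (negbTE xy) mulr0 sub0r mulr1 -expr2 sqrr_sign scaleN1r.
  by rewrite opprK addrC subrK.
have [->|zox] := eqVneq z (opp x).
  rewrite !evec_opp /= eqxx (negbTE xy) mulr0 subr0 mulr1 signrN mulNr -expr2.
  by rewrite sqrr_sign scaleN1r opprK addrA addNr sub0r.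
have [->|zoy] := eqVneq z (opp y).
  rewrite !evec_opp /= eqxx eq_sym (negbTE xy) mulr0 sub0r mulr1 signrN mulNr -expr2.
  by rewrite sqrr_sign opprK scale1r opprB addrA addNr sub0r.
have neq a : z != a -> z != opp a -> (z.1 == a.1) = false.
  case: (z) a => i b [j c]; rewrite !xpair_eqE /=; case: eqP => //= _.
  by case: b; case: c.
by rewrite !neq // !mulr0 subrr scale0r subr0.
Qed.

Lemma outerN (v : 'rV[rat]_n) : (- v)^T *m (- v) = v^T *m v.
Proof.
by apply/matrixP=> i j; rewrite !mxE; apply: eq_bigr => k _; rewrite !mxE mulrNN.
Qed.

(** Opposite letters give the opposite root, hence the same matrix, and [srho] is faithful on
    [WB n]. *)
Lemma refl2_opp x y : x.1 != y.1 -> refl2 (opp x) (opp y) = refl2 x y.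
Proof.
move=> xy; apply: srho_inj; rewrite ?refl2_WB //.
by rewrite (srho_refl2 xy) (@srho_refl2 (opp x) (opp y) xy) !evec_opp -opprD outerN.
Qed.

Lemma refl2C x y : x.1 != y.1 -> refl2 x y = refl2 y x.
Proof.
move=> xy; have yx : y.1 != x.1 by rewrite eq_sym.
apply: srho_inj; rewrite ?refl2_WB //.
by rewrite (srho_refl2 xy) (srho_refl2 yx) -(opprB (evec x)) outerN.
Qed.

Lemma WB_fst u x y : u \in WB n -> ((u x).1 == (u y).1) = (x.1 == y.1).
Proof.
have same_fst (a b : letter n) : (a.1 == b.1) = (a == b) || (a == opp b).
  case: a b => i b [j c]; rewrite !xpair_eqE /=; case: (_ == _) => //=.
  by case: b; case: c.
by move=> uW; rewrite !same_fst -WBE // !(inj_eq perm_inj).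
Qed.

Lemma refl2_conj x y u : x.1 != y.1 -> u \in WB n ->
  (refl2 x y ^ u)%g = refl2 (u x) (u y).
Proof.
by move=> xy uW; rewrite !refl2E ?WB_fst // conjMg !tpermJ !WBE.
Qed.

Lemma refl2_TD x y : x.1 != y.1 -> refl2 x y \in TD n.
Proof.
have lt_case (a c : letter n) : (a.1 < c.1)%N -> refl2 a c \in TD n.
  move=> ac; have ne : a.1 != c.1 by rewrite -val_eqE /= ltn_eqF.
  rewrite inE; apply/existsP; exists a.1; apply/existsP; exists c.1; rewrite ac /=.
  case: a c ac ne => i [] [j []] ac ne; last 2 first.
  - by rewrite eqxx orbT.
  - by rewrite eqxx.
  - by rewrite -refl2_opp //= eqxx.
  by rewrite -refl2_opp //= eqxx orbT.
move=> xy; have := xy; rewrite neq_ltn => /orP[/lt_case//|yx].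
by rewrite refl2C // lt_case.
Qed.

Lemma TD_P t : t \in TD n -> exists (i : 'I_n) (y : letter n),
  (i < y.1)%N /\ t = refl2 (pos i) y.
Proof.
rewrite inE => /existsP[i /existsP[j /andP[ij /orP[]/eqP->]]].
  by exists i, (pos j).
by exists i, (neg j).
Qed.

(** Along the doubled list the sign changes only at the end of either half. A letter outside [r] has
    index [size r], so the test fails for it, as it should. *)
Lemma bcyc_pos (r : seq 'I_n) x : uniq r -> bcyc [seq pos i | i <- r] x =
  (cyc r x.1, x.2 (+) ((index x.1 r).+1 == size r)).
Proof.
case: x => i b ur /=; set s := [seq pos i | i <- r].
have us : uniq (s ++ map opp s).
  have pos_inj : injective (fun i : 'I_n => pos i) by move=> ? ? [].
  rewrite cat_uniq (map_inj_uniq (can_inj opp_involutive)) !(map_inj_uniq pos_inj).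
  rewrite ur andbT /=; apply/hasPn => _ /mapP[_ /mapP[j _ ->] ->].
  by apply/negP => /mapP[k _ []].
have szs : size (s ++ map opp s) = (size r + size r)%N by rewrite size_cat !size_map.
have [ir|ir] := boolP (i \in r); last first.
  rewrite /bcyc !cyc_out //; first by rewrite memNindex // gtn_eqF // addbF.
  rewrite mem_cat negb_or; apply/andP; split; apply/mapP.
    by move=> [j jr [ij _]]; rewrite ij jr in ir.
  by move=> [_ /mapP[j jr ->] [ij _]]; rewrite ij jr in ir.
set k := index i r; have kr : (k < size r)%N by rewrite index_mem.
pose d := pos i.
(* The sign [c], read as 0 or 1, selects the half of the doubled list. *)
have nthE (c : bool) l : (l < size r)%N -> nth d (s ++ map opp s) (c * size r + l) = (nth i r l, c).
  move=> lr; rewrite nth_cat size_map; case: c; rewrite ?mul1n ?mul0n ?add0n.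
    by rewrite ltnNge leq_addr /= addKn (nth_map d) ?size_map // (nth_map i).
  by rewrite lr (nth_map i).
have iE : (i, b) = nth d (s ++ map opp s) (b * size r + k) by rewrite nthE // nth_index.
have bk : (b * size r + k < size (s ++ map opp s))%N.
  by rewrite szs; case: b {iE}; rewrite ?mul1n ?mul0n ?add0n ?ltn_add2l // ltn_addr.
rewrite /bcyc {1}iE cyc_nth // szs.
rewrite -{1}(nth_index i ir) -/k cyc_nth //.
have [kr1|kr1] := eqVneq k.+1 (size r).
  rewrite kr1 modnn; case: b {iE bk}; rewrite /= ?mul1n ?mul0n ?add0n.
    by rewrite -addnS kr1 modnn -(nthE false) ?mul0n ?add0n //; lia.
  by rewrite kr1 modn_small -?(nthE true) ?mul1n ?addn0 //; lia.
have kr2 : (k.+1 < size r)%N by lia.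
rewrite addbF [in RHS]modn_small // modn_small.
  by rewrite -addnS nthE.
by case: b {iE bk}; rewrite /= ?mul1n ?mul0n ?add0n; lia.
Qed.

Lemma refl1_val (i : 'I_n) x : refl1 i x = (x.1, x.2 (+) (x.1 == i)).
Proof.
rewrite /refl1 (bcyc_pos (r := [:: i])) //=; congr (_, _).
  have [->|xi] := eqVneq x.1 i; last by rewrite cyc_out // inE.
  by rewrite permE undup_id //= eqxx.
by rewrite [i == _]eq_sym; case: (x.1 == i).
Qed.

Lemma refl1_WB (i : 'I_n) : refl1 i \in WB n.
Proof.
by rewrite inE; apply/forallP => x; rewrite !refl1_val /Defs.opp /= addNb.
Qed.

Lemma refl1_conj i u : u \in WB n -> (refl1 i ^ u)%g = refl1 (u (pos i)).1.
Proof.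
move=> uW; apply/permP => x; rewrite -[x](permKV u); set z := (u^-1)%g x.
rewrite permJ !refl1_val.
rewrite WB_fst //=.
case: z => k b /=; have [ki|] := eqVneq k i; last by rewrite !addbF; case: (u _).
by rewrite !addbT -[(k, ~~ b)]/(opp (k, b)) WBE.
Qed.

Lemma srho_refl1 (i : 'I_n) :
  srho (refl1 i) = 1%:M - 2%:R *: ((evec (pos i))^T *m evec (pos i)).
Proof.
apply: reflection_mx => k; rewrite rowK -evec_pos refl1_val dot_evec /= !expr0 !mul1r.
have [->|ki] := eqVneq k i; last by rewrite mulr0 scale0r subr0.
by rewrite -[(i, _)]/(opp (pos i)) evec_opp mulr1 scaler_nat mulr2n opprD addrA subrr sub0r.
Qed.

End SignedPermutations.

(** * Unsigned permutations as signed ones *)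

Section Lift.

Variable n : nat.

Lemma lift_subproof (s : {perm 'I_n}) : injective (fun x : letter n => (s x.1, x.2)).
Proof. by move=> [i b] [j c] [/perm_inj-> ->]. Qed.

Definition lift_perm (s : {perm 'I_n}) : {perm letter n} := perm (@lift_subproof s).

Lemma lift_permE s x : lift_perm s x = (s x.1, x.2).
Proof. by rewrite permE. Qed.

(** Through this lift the length bound for permutations applies to the unsigned factor of the
    Coxeter elements of types B and D. *)
Lemma lift_perm_expg (T : {set {perm letter n}}) k s :
  (forall i j : 'I_n, i != j -> refl2 (pos i) (pos j) \in T) ->
  (s \in TA n ^+ k -> lift_perm s \in T ^+ k)%g.
Proof.
move=> posT; elim: k s => [|k IH] s.
  rewrite !expg0 => /set1P->; apply/set1P/permP => -[i b].
  by rewrite lift_permE !perm1.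
rewrite !expgSr => /mulsgP[u t uT tT ->].
have -> : lift_perm (u * t) = (lift_perm u * lift_perm t)%g.
  by apply/permP => x; rewrite permM !lift_permE permM.
apply: mem_mulg; first exact: IH.
have [i [j [ij -> _]]] := rootA_P tT.
have ij' : i != j by rewrite -val_eqE /= ltn_eqF.
have -> : lift_perm (tperm i j) = refl2 (pos i) (pos j); last exact: posT.
apply/permP => -[k' b]; rewrite lift_permE refl2_val //= permE /= !xpair_eqE /=.
by case: b; case: eqP => //=; case: eqP.
Qed.

End Lift.

(** * Root data common to types B and D *)

Section SignedRootData.

Variable n : nat.
Implicit Types (x y z : letter n) (t u : {perm letter n}).

(* [(i, Some y)] encodes the long root [evec (pos i) - evec y], [(i, None)] the
   short root [evec (pos i)]. *)
Definition rootS : {perm letter n} -> 'rV[rat]_n :=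
  root_of (fun p : 'I_n * option (letter n) => if p.2 is Some y then (p.1 < y.1)%N else true)
    (fun p => if p.2 is Some y then refl2 (pos p.1) y else refl1 p.1)
    (fun p => if p.2 is Some y then evec (pos p.1) - evec y else evec (pos p.1)).

Lemma rootS_P t : t \in TB n ->
  (exists (i : 'I_n) y, [/\ (i < y.1)%N, t = refl2 (pos i) y
     & rootS t = evec (pos i) - evec y]) \/
  (exists i : 'I_n, t = refl1 i /\ rootS t = evec (pos i)).
Proof.
move=> tT; have [|[i [y|]] /= [iy tE rE]] := @root_ofP _ _ 'rV[rat]_n
    (fun p : 'I_n * option (letter n) => if p.2 is Some y then (p.1 < y.1)%N else true)
    (fun p => if p.2 is Some y then refl2 (pos p.1) y else refl1 p.1)
    (fun p => if p.2 is Some y then evec (pos p.1) - evec y else evec (pos p.1)) t.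
- move: tT; rewrite inE => /orP[/TD_P[i [y [iy ->]]]|/imsetP[i _ ->]].
    by exists (i, Some y).
  by exists (i, None).
- by left; exists i, y.
by right; exists i.
Qed.

Lemma TB_WB : TB n \subset WB n.
Proof.
apply/subsetP => t /rootS_P[[i [y [iy -> _]]]|[i [-> _]]]; last exact: refl1_WB.
by rewrite refl2_WB // -val_eqE /= ltn_eqF.
Qed.

Lemma TB_conj t u : t \in TB n -> u \in WB n -> (t ^ u)%g \in TB n.
Proof.
move=> /rootS_P[[i [y [iy -> _]]]|[i [-> _]]] uW; last first.
  by rewrite refl1_conj // inE imset_f ?orbT.
have ne : (pos i).1 != y.1 by rewrite -val_eqE /= ltn_eqF.
by rewrite refl2_conj // inE refl2_TD // WB_fst.
Qed.

Variables (W T : {set {perm letter n}}) (g : {perm letter n}) (K : 'M[rat]_n).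
(** The weights n - i are positive, for the roots e_i and e_i + e_j, and decreasing, for the roots
    e_i - e_j with i < j. *)
Definition htS : 'cV[rat]_n := \col_i (n - i)%:R.

Hypothesis W1 : 1%g \in W.
Hypothesis WM : {in W &, forall t u, (t * u)%g \in W}.
Hypothesis W_WB : W \subset WB n.
Hypothesis T_W : T \subset W.
Hypothesis T_TB : T \subset TB n.
Hypothesis T_conj : {in T &, forall t u, (t ^ u)%g \in T}.
Hypothesis gW : g \in W.
Hypothesis g_len : (abs_length T g <= n)%N.
Hypothesis n_gt0 : (0 < n)%N.
Hypothesis K_inv : (srho g - 1%:M) *m K = 1%:M.
Hypothesis K_sym : forall i j : 'I_n, K i j + K j i = - (i == j)%:R.
Hypothesis K_long : {in T &, forall t u,
    dot (rootS u) (rootS u) = 2%:R -> form K (rootS t) (rootS u) \is a Num.int}.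
Hypothesis K_short : {in T &, forall t u,
    dot (rootS u) (rootS u) = 1 -> 2%:R * form K (rootS t) (rootS u) \is a Num.int}.
Hypothesis K_short_neq0 : {in T &, forall t u, dot (rootS t) (rootS t) = 1 ->
    dot (rootS u) (rootS u) = 1 -> form K (rootS t) (rootS u) != 0}.

Lemma dot_long (i : 'I_n) y : (i < y.1)%N ->
  dot (evec (pos i) - evec y) (evec (pos i) - evec y) = 2%:R.
Proof.
move=> iy; have ne : (i == y.1) = false by rewrite -val_eqE /= ltn_eqF.
rewrite /dot !(formBl, formBr) -!/(dot _ _) !dot_evec /= !eqxx ne eq_sym ne.
by case: y.2; rewrite ?expr0 ?expr1 ?(mulr0n, mulr1n); lra.
Qed.

Lemma dot_short (i : 'I_n) : dot (evec (pos i)) (evec (pos i)) = 1.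
Proof. by rewrite dot_evec /= eqxx !expr0 !mul1r. Qed.

Lemma card_perm_letter : (n < #|{perm letter n}|)%N.
Proof.
have -> : #|{perm letter n}| = #|[set: letter n]|`!.
  by rewrite -card_perm; apply: eq_card => s; rewrite !inE; apply/esym/subsetP => x; rewrite inE.
rewrite cardsT card_prod card_ord card_bool (leq_trans _ (fact_geq _)) //.
by rewrite muln2 -addnn -[X in (X < _)%N]addn0 ltn_add2l.
Qed.

Lemma KT : K + K^T = - 1%:M.
Proof. by apply/matrixP => i j; rewrite !mxE K_sym. Qed.

Lemma form_sym (x y : 'rV[rat]_n) : form K x y + form K y x = - dot x y.
Proof.
have -> : form K y x = form K^T x y.
  rewrite /form; have <- : (y *m K *m x^T)^T = x *m K^T *m y^T.
    by rewrite !trmx_mul trmxK mulmxA.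
  by rewrite [RHS]mxE.
have : x *m K *m y^T + x *m K^T *m y^T = - (x *m 1%:M *m y^T).
  by rewrite -mulmxDl -mulmxDr KT mulmxN mulNmx.
by move/matrixP/(_ 0 0); rewrite [LHS]mxE [RHS]mxE.
Qed.

Lemma K_inv' : K *m (srho g - 1%:M) = 1%:M.
Proof. exact: mulmx1C K_inv. Qed.

Lemma signed_root_data : root_data W T g (@srho n) rootS K htS.
Proof.
have inWB : {subset W <= WB n} by apply/subsetP.
have inTB : {subset T <= TB n} by apply/subsetP.
split=> //.
- move=> t /inTB/rootS_P[[i [y [iy -> _]]]|[i [-> _]]].
    have ne : (pos i).1 != y.1 by rewrite -val_eqE /= ltn_eqF.
    by rewrite -{2}refl2_opp // !refl2E // invMg !tpermV !opp_involutive.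
  apply/eqP; rewrite eq_invg_mul; apply/eqP/permP => x.
  by rewrite permM !refl1_val perm1 /= -addbA addbb addbF; case: x.
- exact: srho1.
- by move=> t u /inWB tW /inWB uW; apply: srhoM.
- move=> t /inTB/rootS_P[[i [y [iy -> ->]]]|[i [-> ->]]].
    by rewrite dot_long // divff ?scale1r ?srho_refl2 // -val_eqE /= ltn_eqF.
  by rewrite dot_short divr1 srho_refl1.
- suff -> : \rank (srho g - 1%:M) = n by [].
  have [/mulmx1_unit[]] := K_inv; rewrite -row_full_unit => /eqP.
  by rewrite /row_full => ->.
- exact: leq_ltn_trans card_perm_letter.
- by move=> t u /inWB tW /inWB uW; apply: srho_inj.
- move=> t /inTB/rootS_P[[i [y [iy _ ->]]]|[i [_ ->]]].
    by right; apply: dot_long.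
  by left; apply: dot_short.
- have hE x : (evec x *m htS) 0 0 = (-1) ^+ x.2 * (n - x.1)%:R.
    by rewrite /evec -scalemxAl mxE -rowE !mxE.
  move=> t /inTB/rootS_P[[i [[j b] /= [ij _ ->]]]|[i [_ ->]]].
    rewrite mulmxBl mxE [X in _ + X]mxE !hE /= expr0 mul1r.
    have : ((n - j)%:R : rat) < (n - i)%:R by rewrite ltr_nat; have := ltn_ord j; lia.
    by have := ler0n rat (n - j); case: b; rewrite ?expr0 ?expr1; lra.
  by rewrite hE expr0 mul1r ltr0n subn_gt0.
- by move=> t _; rewrite -mulmxA K_inv' mulmx1.
by move=> t u _ _; apply: form_sym.
Qed.

End SignedRootData.

(** * Type B *)

Section TypeB.

Variable n : nat.
Hypothesis n_gt1 : (1 < n)%N.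

Lemma last_lt : (n.-1 < n)%N. Proof. by lia. Qed.
Let l := Ordinal last_lt.

(** Since gamma^n = -1, the product of gamma - 1 and 1 + gamma + ... + gamma^(n-1) is -2. The
    inverse is therefore minus half of this sum, and its entries record the order of the two
    indices. *)
Definition KB : 'M[rat]_n :=
  \matrix_(i, j) (if (j < i)%N then 2%:R^-1 else - 2%:R^-1).

(** The balanced cycle differs from the lifted n-cycle only in the sign of the image of the last
    letter; this splits its length as 1 + (n - 1). *)
Lemma coxBE : coxB n = (refl1 l * lift_perm (coxA n))%g.
Proof.
apply/permP => -[i b]; rewrite permM refl1_val lift_permE /coxB.
rewrite bcyc_pos ?enum_uniq // index_enum_ord size_enum_ord /=.
by congr (_, _ (+) _); rewrite -val_eqE /=; apply/eqP/eqP => h; lia.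
Qed.

Lemma coxB_WB : coxB n \in WB n.
Proof.
rewrite coxBE WBM ?refl1_WB // inE; apply/forallP => x.
by rewrite !lift_permE.
Qed.

Lemma refl1_TB (i : 'I_n) : refl1 i \in TB n.
Proof. by rewrite inE imset_f ?orbT. Qed.

Lemma refl2_TB (x y : letter n) : x.1 != y.1 -> refl2 x y \in TB n.
Proof. by move=> xy; rewrite inE refl2_TD. Qed.

Lemma coxA_len : (abs_length (TA n) (coxA n) <= n.-1)%N.
Proof. by apply: abs_length_TA => i; have := ltn_ord i; lia. Qed.

Lemma coxB_len : (abs_length (TB n) (coxB n) <= n)%N.
Proof.
rewrite coxBE (leq_trans (abs_lengthM _ _ _)) //.
have l1 := abs_length_refl (refl1_TB l).
have l2 : (abs_length (TB n) (lift_perm (coxA n)) <= n.-1)%N.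
  rewrite (leq_trans (abs_lengthP _) coxA_len) //; apply: lift_perm_expg.
    by move=> i j ij; apply: refl2_TB.
  apply: abs_length_mem.
  by rewrite card_Sn (leq_ltn_trans coxA_len) // (leq_trans _ (fact_geq _)) //; lia.
by lia.
Qed.

Lemma evec_mul (K : 'M[rat]_n) (x : letter n) : evec x *m K = (-1) ^+ x.2 *: row x.1 K.
Proof. by rewrite /evec -scalemxAl -rowE. Qed.

Lemma KB_inv : (srho (coxB n) - 1%:M) *m KB = 1%:M.
Proof.
apply/row_matrixP => i; rewrite row_mul linearB /= rowK mulmxBl -row_mul mul1mx.
rewrite coxBE permM refl1_val lift_permE evec_mul /=.
apply/rowP => j; rewrite !mxE coxA_val -!val_eqE /=.
have := ltn_ord i; rewrite leq_eqVlt => /orP[/eqP i_n|i_n].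
  have -> : (i == n.-1 :> nat) by apply/eqP; lia.
  rewrite i_n modnn expr1.
  have [ji|ij|ji] := ltngtP (j : nat) i; rewrite ?(mulr0n, mulr1n) /=; try lra.
  by have := ltn_ord j; lia.
have -> : (i == n.-1 :> nat) = false by apply/eqP; lia.
rewrite modn_small // ltnS expr0.
by case: (ltngtP (j : nat) i) => ji; rewrite ?(mulr0n, mulr1n) /=; lra.
Qed.

Lemma KB_sym (i j : 'I_n) : KB i j + KB j i = - (i == j)%:R.
Proof.
rewrite !mxE -val_eqE /=.
by case: (ltngtP (j : nat) i) => ji; rewrite ?(mulr0n, mulr1n) /=; lra.
Qed.

(** All pairings of letters are 1/2 or -1/2, hence in one coset of the integers. Against a long
    root, a difference of two letters, the halves cancel. *)
Lemma form_KB x y : form KB (evec x) (evec y) + 2%:R^-1 \is a Num.int.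
Proof.
rewrite form_evec mxE.
have H : (- 2%:R^-1 + 2%:R^-1 : rat) \is a Num.int by rewrite addNr.
have H' : (2%:R^-1 + 2%:R^-1 : rat) \is a Num.int by [].
by case: x.2; case: y.2; case: ifP => _;
   rewrite ?(expr0, expr1, mul1r, mulN1r, mulrN1, mulr1, opprK).
Qed.

Lemma root_dataB : root_data (WB n) (TB n) (coxB n) (@srho n) (@rootS n) KB (htS n).
Proof.
have two x y : 2%:R * form KB (evec x) (evec y) \is a Num.int.
  have -> : 2%:R * form KB (evec x) (evec y) =
    2%:R * (form KB (evec x) (evec y) + 2%:R^-1) - 1 by field.
  by rewrite rpredB // rpredM // form_KB.
apply: signed_root_data => //.
- exact: WB1.
- exact: WBM.
- exact: TB_WB.
- by move=> t u tT uT; apply: TB_conj => //; apply: (subsetP (TB_WB n)).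
- exact: coxB_WB.
- exact: coxB_len.
- by lia.
- exact: KB_inv.
- exact: KB_sym.
- move=> t u tT /rootS_P[[k [z [kz _ ->]]]|[k [_ ->]]]; last by rewrite dot_short; lra.
  case/rootS_P: tT => [[i [y [iy _ ->]]]|[i [_ ->]]] _; rewrite !(formBl, formBr).
    set a := form _ _ _; set b := form _ _ _; set c := form _ _ _; set d := form _ _ _.
    have -> : a - b - (c - d) = (a + 2%:R^-1) - (b + 2%:R^-1) - ((c + 2%:R^-1) - (d + 2%:R^-1)).
      by ring.
    by rewrite !rpredB // form_KB.
  set a := form _ _ _; set b := form _ _ _.
  have -> : a - b = (a + 2%:R^-1) - (b + 2%:R^-1) by ring.
  by rewrite !rpredB // form_KB.
- move=> t u tT /rootS_P[[k [z [kz _ ->]]]|[k [_ ->]]]; first by rewrite dot_long //; lra.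
  by case/rootS_P: tT => [[i [y [iy _ ->]]]|[i [_ ->]]] _; rewrite ?formBl ?mulrBr ?rpredB.
move=> t u /rootS_P[[i [y [iy _ ->]]]|[i [_ ->]]]; first by rewrite dot_long //; lra.
case/rootS_P => [[k [z [kz _ ->]]]|[k [_ ->]]] _; first by rewrite dot_long //; lra.
by rewrite form_evec !expr0 !mul1r mxE; case: ifP => _ _; rewrite ?oppr_eq0 invr_eq0.
Qed.

End TypeB.

Lemma strict_total_asym (L : finType) (A : {set L}) (lt : rel L) :
  strict_total_order_on A lt -> {in A &, forall x y, lt x y -> ~~ lt y x}.
Proof.
move=> [ltI ltT _] x y xA yA xy; apply/negP => yx.
by have := ltI _ xA; rewrite (ltT _ _ _ xA yA xA xy yx).
Qed.

Ltac bool_lra := rewrite ?(eqxx, expr0, expr1, mulr0n, mulr1n) /=; lra.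

(** * Compatible orders in type B *)

Section ObtuseB.

Variable n : nat.
Hypothesis n_gt1 : (1 < n)%N.

Lemma refl2_negC (i j : 'I_n) : i != j -> refl2 (pos i) (neg j) = refl2 (pos j) (neg i).
Proof. by move=> ij; rewrite refl2C // -refl2_opp //= eq_sym. Qed.

Lemma dot_long2 (i k : 'I_n) (y z : letter n) :
  dot (evec (pos i) - evec y) (evec (pos k) - evec z) =
  (i == k)%:R - (-1) ^+ z.2 * (i == z.1)%:R - (-1) ^+ y.2 * (y.1 == k)%:R
  + (-1) ^+ y.2 * (-1) ^+ z.2 * (y.1 == z.1)%:R.
Proof.
by rewrite /dot !(formBl, formBr) -!/(dot _ _) !dot_evec /= !expr0; ring.
Qed.

Lemma form_long2 K (i k : 'I_n) (y z : letter n) :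
  form K (evec (pos i) - evec y) (evec (pos k) - evec z) =
  K i k - (-1) ^+ z.2 * K i z.1 - (-1) ^+ y.2 * K y.1 k
  + (-1) ^+ y.2 * (-1) ^+ z.2 * K y.1 z.1.
Proof. by rewrite !(formBl, formBr) !form_evec /= !expr0; ring. Qed.

Lemma form_short_long K (i k : 'I_n) (z : letter n) :
  form K (evec (pos i)) (evec (pos k) - evec z) = K i k - (-1) ^+ z.2 * K i z.1.
Proof. by rewrite formBr !form_evec /= !expr0; ring. Qed.

Lemma form_long_short K (i k : 'I_n) (y : letter n) :
  form K (evec (pos i) - evec y) (evec (pos k)) = K i k - (-1) ^+ y.2 * K y.1 k.
Proof. by rewrite formBl !form_evec /= !expr0; ring. Qed.

Lemma KB_lt (i j : 'I_n) : (j < i)%N -> KB n i j = 2%:R^-1.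
Proof. by rewrite mxE => ->. Qed.

Lemma KB_ge (i j : 'I_n) : (i <= j)%N -> KB n i j = - 2%:R^-1.
Proof. by rewrite mxE leqNgt => /negbTE->. Qed.

(** The cases follow the coincidences among indices and then the signs. In each, chi is nonzero, or
    the angle is already non-acute, or a clause of [compatibleB] puts [u] before [t], or the two
    reflections are equal. *)
Lemma obtuseB lt : strict_total_order_on (TB n) lt -> compatibleB lt ->
  {in TB n &, forall t u, lt t u -> form (KB n) (rootS t) (rootS u) = 0 ->
    dot (rootS t) (rootS u) <= 0}.
Proof.
move=> tot [comp1 comp2 comp3] t u tT uT tu.
have [ltI _ _] := tot.
have asym := strict_total_asym tot tT uT tu; have irr := ltI _ tT.
have ne (i j : 'I_n) : (i < j)%N -> (i == j) = false /\ (j == i) = false.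
  by move=> ij; split; apply/eqP => e; move: ij; rewrite e ltnn.
case/rootS_P: tT tu asym irr => [[i [[j b] /= [ij -> ->]]]|[i [-> ->]]];
  case/rootS_P: uT => [[k [[l c] /= [kl -> ->]]]|[k [-> ->]]] tu asym irr.
- rewrite form_long2 dot_long2 /=; have [ij1 ij2] := ne _ _ ij; have [kl1 kl2] := ne _ _ kl.
  have [eik|nik] := eqVneq i k.
    subst k; have [ejl|njl] := eqVneq j l.
      subst l; rewrite ij1 ij2; case: b c tu irr {asym} => [] [] tu irr;
        by [rewrite (negbTE irr) in tu | bool_lra].
    have [lj|jl] := ltnP l j; last first.
      rewrite (KB_ge (leqnn i)) (KB_ge (ltnW kl)) (KB_lt ij) (KB_ge jl).
      by case: b c {tu asym irr} => [] []; bool_lra.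
    rewrite (KB_ge (leqnn i)) (KB_ge (ltnW kl)) (KB_lt ij) (KB_lt lj).
    case: b c {tu irr} asym => [] [] asym; last 1 first.
    + have /comp1[h _] : (i < l < j)%N by rewrite kl lj.
      by case/negP: asym; exact: h.
    (* The second clause, with its third index below the other two, compares these reflections after
       [refl2_negC] exchanges which letter carries the sign. *)
    + have [|_ h] := comp2 l j i lj; first by rewrite kl.
      have e : lt (refl2 (pos i) (neg l)) (refl2 (pos i) (neg j)).
        by rewrite (refl2_negC (negbT kl1)) (refl2_negC (negbT ij1)).
      by case/negP: asym; exact: e.
    + have [|h _] := comp2 i l j kl; first by rewrite lj orbT.
      by case/negP: asym; exact: h.
    by bool_lra.
  have [ejl|njl] := eqVneq j l.
    subst l; rewrite ij1 kl2 (KB_ge (ltnW ij)) (KB_lt kl) (KB_ge (leqnn j)).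
    have [ki|ik] := ltnP k i; last first.
      by rewrite (KB_ge ik); case: b c {tu asym irr} => [] []; bool_lra.
    rewrite (KB_lt ki); case: b c {tu irr} asym => [] [] asym; try by bool_lra.
      have [|_ h] := comp2 k i j ki; first by rewrite ij orbT.
      by case/negP: asym; exact: h.
    have /comp1[_ h] : (k < i < j)%N by rewrite ki ij.
    by case/negP: asym; exact: h.
  have [eil|neil] := eqVneq i l.
    subst l; have kj := ltn_trans kl ij; have [_ ->] := ne _ _ kj.
    rewrite (KB_lt kl) (KB_ge (leqnn i)) (KB_lt kj) (KB_lt ij).
    by case: b c {tu asym irr} => [] []; bool_lra.
  have [ejk|njk] := eqVneq j k; last by move=> _; bool_lra.
  subst k; have il := ltn_trans ij kl.
  rewrite (KB_ge (ltnW ij)) (KB_ge (ltnW il)) (KB_ge (leqnn j)) (KB_ge (ltnW kl)).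
  case: b c {tu irr} asym => [] [] asym; try by bool_lra.
  have [|h _] := comp2 j l i kl; first by rewrite ij.
  have e : lt (refl2 (pos j) (pos l)) (refl2 (pos i) (neg j)).
    by rewrite (refl2_negC (negbT ij1)).
  by case/negP: asym; exact: e.
- rewrite form_long_short [X in X <= 0]form_long_short !mxE /=.
  have [ij1 ij2] := ne _ _ ij; have [h1 h2 h3] := comp3 _ _ ij.
  have [eik|nik] := eqVneq i k.
    subst k; rewrite ij2 ltnn ij; case: b tu asym {irr} => tu asym.
      by case/negP: asym; exact: h2.
    by bool_lra.
  have [ejk|njk] := eqVneq j k; last by move=> _; bool_lra.
  subst k; rewrite ltnn ltnNge (ltnW ij); case: b {tu asym irr} => /=; bool_lra.
- rewrite form_short_long [X in X <= 0]form_short_long !mxE /=.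
  have [kl1 kl2] := ne _ _ kl; have [h1 h2 h3] := comp3 _ _ kl.
  have [eik|nik] := eqVneq i k.
    subst k; rewrite kl1 ltnn ltnNge (ltnW kl); case: c tu asym {irr} => tu asym.
      by bool_lra.
    by case/negP: asym; exact: h1.
  have [eil|neil] := eqVneq i l; last by move=> _; bool_lra.
  subst l; rewrite ltnn kl; case: c tu asym {irr} => tu asym; last by bool_lra.
  by case/negP: asym; exact: h3.
have [eik|nik] := eqVneq i k; first by subst k; rewrite (negbTE irr) in tu.
by rewrite dot_evec /= (negbTE nik) mulr0.
Qed.

Theorem EL_labelingB lt : strict_total_order_on (TB n) lt -> compatibleB lt ->
  EL_labeling (TB n) lt (@natural_label _ (WB n) (TB n) (coxB n)).
Proof.
move=> tot comp; apply: (EL_labeling_of_root_data (root_dataB n_gt1) tot).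
exact: obtuseB.
Qed.

End ObtuseB.

(** * Type D *)

Section TypeD.

Variable n : nat.
Hypothesis n_gt2 : (2 < n)%N.

Lemma lt_pred1 : (n.-1 < n)%N. Proof. by lia. Qed.
Lemma lt_pred2 : (n.-2 < n)%N. Proof. by lia. Qed.
Let l := Ordinal lt_pred1.
Let m := Ordinal lt_pred2.
Let r := [seq i : 'I_n <- enum 'I_n | (i < n.-1)%N].
Let rE : map val r = iota 0 n.-1 := map_val_enum_ord_lt (leq_pred n).

(** A block inverse: gamma acts on the first n - 1 coordinates as the type B element of that rank
    and on the last by -1, where gamma - 1 is -2. *)
Definition KD : 'M[rat]_n :=
  \matrix_(i, j) (if (i == l) || (j == l) then - 2%:R^-1 * (i == j)%:R else KB n i j).

Lemma coxDE : coxD n = (refl1 l * (refl1 m * lift_perm (cyc r)))%g.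
Proof.
rewrite /coxD /perm_comp; congr (_ * _)%g.
  rewrite /refl1 -[[:: pos l]]/[seq pos i | i <- [:: l]].
  rewrite -(filter_pred1_uniq (enum_uniq 'I_n) (mem_enum _ _)).
  by congr (bcyc (map _ _)); apply: eq_filter => i /=; rewrite -val_eqE.
apply/permP => -[i b]; rewrite permM refl1_val lift_permE bcyc_pos ?(uniq_iota_ord rE) //.
rewrite (size_iota_ord rE) (index_iota_ord rE) /=.
by congr (_, _ (+) _); rewrite -val_eqE /=; apply/eqP/eqP => h; lia.
Qed.

Lemma WD_WB : WD n \subset WB n.
Proof.
have WB_group : group_set (WB n).
  by apply/group_setP; split; [apply: WB1 | move=> u v; apply: WBM].
rewrite -[WB n]/(Group WB_group : {set _}) gen_subG /=.
by rewrite (subset_trans _ (TB_WB n)) // subsetUl.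
Qed.

(** The sign changes [n-1] and [n] do not lie in type D separately, but their product is that of the
    reflections in e_(n-1) - e_n and e_(n-1) + e_n. With at most n - 2 reflections for the lifted
    (n-1)-cycle this makes at most n. *)
Lemma coxD_expg : exists2 k, (k <= n)%N & coxD n \in (TD n ^+ k)%g.
Proof.
have len : (abs_length (TA n) (cyc r) <= n.-2)%N.
  apply: abs_length_TA => i ip; apply: val_inj.
  by rewrite /= (cyc_iota_ord rE) ltnNge ip.
exists (2 + abs_length (TA n) (cyc r))%N; first by lia.
rewrite coxDE mulgA expgD mem_mulg //.
  have -> : (refl1 l * refl1 m = refl2 (pos m) (pos l) * refl2 (pos m) (neg l))%g.
    have ml : (m == l) = false by apply/eqP => /(congr1 val) /=; lia.
    have lm : (l == m) = false by rewrite eq_sym ml.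
    apply/permP => -[i b]; rewrite permM [RHS]permM !refl1_val !refl2_val /= ?ml //.
    rewrite !xpair_eqE /=; have [->|im] := eqVneq i m.
      by case: b; rewrite ?(ml, lm, eqxx, xpair_eqE).
    have [->|il] := eqVneq i l; first by case: b; rewrite ?(ml, lm, eqxx, xpair_eqE).
    by rewrite /= !xpair_eqE (negbTE im) (negbTE il) !addbF.
  by rewrite expg2 mem_mulg // refl2_TD // -val_eqE /=; lia.
apply: lift_perm_expg; first by move=> i j ij; apply: refl2_TD.
by apply: abs_length_mem; rewrite card_Sn (leq_ltn_trans len) // (leq_trans _ (fact_geq _)) //; lia.
Qed.

Lemma KD_inv : (srho (coxD n) - 1%:M) *m KD = 1%:M.
Proof.
apply/row_matrixP => i; rewrite row_mul linearB /= rowK mulmxBl -row_mul mul1mx.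
rewrite coxDE !permM !refl1_val lift_permE evec_mul /=.
have cv := cyc_iota_ord rE i.
apply/rowP => j; rewrite !mxE.
rewrite -!val_eqE /= cv.
have := ltn_ord i; have := ltn_ord j => jn i_n.
have [il|il] := eqVneq (i : nat) n.-1.
  have -> : (i == n.-2 :> nat) = false by apply/eqP; lia.
  have -> : (i < n.-1)%N = false by apply/negP; lia.
  rewrite il eqxx /= expr1 [n.-1 == _ :> nat]eq_sym; case: (_ == _); bool_lra.
have i_l : (i < n.-1)%N by lia.
rewrite i_l /=.
have [im|im] := eqVneq (i : nat) n.-2.
  have -> : i.+1 = n.-1 by lia.
  rewrite modnn expr1 /=.
  have -> : (0 == n.-1)%N = false by apply/eqP; lia.
  rewrite /=; have [jl|jl] := eqVneq (j : nat) n.-1.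
    have -> : (0 == j :> nat) = false by apply/eqP; lia.
    by have -> : (i == j :> nat) = false; [apply/eqP; lia | bool_lra].
  by rewrite ?ltn0; case: (ltngtP (j : nat) i) => ji; [bool_lra | lia | bool_lra].
rewrite modn_small ?expr0; last by lia.
have -> : (i.+1 == n.-1)%N = false by apply/eqP; lia.
rewrite ltnS /=; have [jl|jl] := eqVneq (j : nat) n.-1.
  have -> : (i.+1 == j)%N = false by apply/eqP; lia.
  by have -> : (i == j :> nat) = false; [apply/eqP; lia | bool_lra].
by case: (ltngtP (j : nat) i) => ji; bool_lra.
Qed.

Lemma KD_sym (i j : 'I_n) : KD i j + KD j i = - (i == j)%:R.
Proof.
have := KB_sym i j; rewrite [KD i j]mxE [KD j i]mxE [in RHS]eq_sym orbC [j == i]eq_sym.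
case: ifP => // _ _; case: (i == j); bool_lra.
Qed.

Lemma refl2_neq_refl1 (x y : letter n) i : x.1 != y.1 -> refl2 x y != refl1 i.
Proof.
move=> xy; apply/eqP => e; have := congr1 (fun s : {perm letter n} => (s x).1) e.
by rewrite refl2_val // eqxx refl1_val /= => yx; rewrite yx eqxx in xy.
Qed.

Lemma rootD_P t : t \in TD n -> exists (i : 'I_n) (y : letter n), [/\ (i < y.1)%N,
  t = refl2 (pos i) y & rootS t = evec (pos i) - evec y].
Proof.
move=> tT; have /rootS_P[//|[i [te _]]] : t \in TB n by rewrite inE tT.
have [j [y [jy te']]] := TD_P tT.
have ne : (pos j).1 != y.1 by rewrite -val_eqE /= ltn_eqF.
by have := refl2_neq_refl1 i ne; rewrite -te -te' eqxx.
Qed.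

(** Letters within one block of gamma pair to a half-odd number and letters of different blocks to
    0, hence a correction by 1/2 exactly within a block. *)
Lemma form_KD x y : form KD (evec x) (evec y) +
  2%:R^-1 * ((x.1 == l) == (y.1 == l))%:R \is a Num.int.
Proof.
have := form_KB x y; rewrite !form_evec [KD _ _]mxE.
have zero (s : rat) : s * (- 2%:R^-1 * false%:R) + 2%:R^-1 * false%:R \is a Num.int.
  by rewrite !mulr0 addr0.
case: (x.1 =P l) => xl; case: (y.1 =P l) => yl /=.
- by rewrite xl yl eqxx mxE ltnn !mulr1.
- by have -> : (x.1 == y.1) = false by rewrite xl; apply/eqP => e; case: yl.
- by have -> : (x.1 == y.1) = false by rewrite yl; apply/eqP => e; case: xl.
by rewrite mulr1.
Qed.

Lemma root_dataD : root_data (WD n) (TD n) (coxD n) (@srho n) (@rootS n) KD (htS n).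
Proof.
have WD1 : 1%g \in WD n by rewrite /WD group1.
have WDM : {in WD n &, forall u v, (u * v)%g \in WD n}.
  by move=> u v; rewrite /WD; apply: groupM.
have TDW : TD n \subset WD n by apply: subset_gen.
have [k kn gk] := coxD_expg.
have dotD t : t \in TD n -> dot (rootS t) (rootS t) = 2%:R.
  by move=> /rootD_P[i [y [iy _ ->]]]; apply: dot_long.
apply: signed_root_data => //.
- exact: WD_WB.
- by apply/subsetP => t tT; rewrite inE tT.
- move=> t u /rootD_P[i [y [iy -> _]]] uT.
  have uW : u \in WB n by apply: (subsetP WD_WB); apply: (subsetP TDW).
  have ne : (pos i).1 != y.1 by rewrite -val_eqE /= ltn_eqF.
  by rewrite refl2_conj // refl2_TD // WB_fst.
- have [s [sT <- _]] := mem_wprod gk.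
  exact: (wprodW WD1 WDM TDW).
- exact: leq_trans (abs_lengthP gk) kn.
- by lia.
- exact: KD_inv.
- exact: KD_sym.
- move=> t u /rootD_P[i [y [iy _ ->]]] /rootD_P[j [z [jz _ ->]]] _.
  rewrite !(formBl, formBr).
  have [il jl] : i != l /\ j != l.
    by rewrite -!val_eqE /=; have := ltn_ord y.1; have := ltn_ord z.1; split; apply/eqP; lia.
  have := form_KD (pos i) (pos j); have := form_KD (pos i) z.
  have := form_KD y (pos j); have := form_KD y z.
  rewrite /= (negbTE il) (negbTE jl).
  set a := form _ (evec y) (evec z); set b := form _ (evec y) _.
  set c := form _ _ (evec z); set d := form _ _ _.
  move=> fa fb fc fd.
  set yl := y.1 == l in fa fb *; set bz := z.1 == l in fa fc *.
  (* Only the second letter of each root can be the last coordinate. The four corrections add up to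
     1 if both are, and to 0 otherwise. *)
  have fr : (2%:R^-1 * (false == false)%:R - 2%:R^-1 * (false == bz)%:R -
      (2%:R^-1 * (yl == false)%:R - 2%:R^-1 * (yl == bz)%:R) : rat) \is a Num.int.
    by case: (yl) (bz) => [] [].
  have := rpredB (rpredB (rpredB fd fc) (rpredB fb fa)) fr.
  suff -> : d - c - (b - a) = d + 2%:R^-1 * (false == false)%:R -
    (c + 2%:R^-1 * (false == bz)%:R) - (b + 2%:R^-1 * (yl == false)%:R -
    (a + 2%:R^-1 * (yl == bz)%:R)) - (2%:R^-1 * (false == false)%:R -
    2%:R^-1 * (false == bz)%:R - (2%:R^-1 * (yl == false)%:R -
    2%:R^-1 * (yl == bz)%:R)) by [].
  by ring.
- by move=> t u _ /dotD-> /eqP.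
by move=> t u /dotD-> _ /eqP.
Qed.

Lemma KD_lt (i j : 'I_n) : (j < i < n.-1)%N -> KD i j = 2%:R^-1.
Proof.
move=> /andP[ji il]; rewrite mxE -!val_eqE /= (ltn_eqF il).
by rewrite (ltn_eqF (ltn_trans ji il)) KB_lt.
Qed.

Lemma KD_ge (i j : 'I_n) : (i <= j < n.-1)%N -> KD i j = - 2%:R^-1.
Proof.
move=> /andP[ij jl]; rewrite mxE -!val_eqE /= (ltn_eqF jl).
by rewrite (ltn_eqF (leq_ltn_trans ij jl)) KB_ge.
Qed.

Lemma KD_last (i j : 'I_n) : (i < n.-1)%N -> j = l -> (KD i j = 0) * (KD j i = 0).
Proof.
move=> il ->; have ne : (i == l) = false by rewrite -val_eqE /= ltn_eqF.
by split; rewrite mxE ?eqxx ?orbT /= 1?[l == i]eq_sym ne mulr0.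
Qed.

Lemma KD_last2 (i : 'I_n) : i = l -> KD i i = - 2%:R^-1.
Proof. by move=> ->; rewrite mxE eqxx mulr1. Qed.

(** Away from the last coordinate the analysis is that of type B. As chi vanishes between the last
    coordinate and the others, acute pairs made of an e_i + e_j and a root involving the last
    coordinate acquire chi = 0 whatever the sign there; the third clause of [compatibleD] puts these
    in order. *)
Lemma obtuseD lt : strict_total_order_on (TD n) lt -> compatibleD lt ->
  {in TD n &, forall t u, lt t u -> form KD (rootS t) (rootS u) = 0 ->
    dot (rootS t) (rootS u) <= 0}.
Proof.
move=> tot [comp1 comp2 comp3] t u tT uT tu.
have [ltI _ _] := tot.
have asym := strict_total_asym tot tT uT tu; have irr := ltI _ tT.
have ne (i j : 'I_n) : (i < j)%N -> (i == j) = false /\ (j == i) = false.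
  by move=> ij; split; apply/eqP => e; move: ij; rewrite e ltnn.
have lastP (i : 'I_n) : (i < n.-1)%N \/ i = l.
  have := ltn_ord i; case: (ltnP i n.-1) => il; [by left|right].
  by apply: val_inj => /=; lia.
case/rootD_P: tT tu asym irr => [i [[j b] /= [ij -> ->]]].
case/rootD_P: uT => [k [[p c] /= [kp -> ->]]] tu asym irr.
have il : (i < n.-1)%N by have := ltn_ord j; lia.
have kl : (k < n.-1)%N by have := ltn_ord p; lia.
rewrite form_long2 dot_long2 /=; have [ij1 ij2] := ne _ _ ij; have [kp1 kp2] := ne _ _ kp.
have [eik|nik] := eqVneq i k.
  subst k; have [ejp|njp] := eqVneq j p.
    subst p; rewrite ij1 ij2; case: b c tu irr {asym} => [] [] tu irr;
      by [rewrite (negbTE irr) in tu | bool_lra].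
  case: (lastP j) => [jl|jl]; case: (lastP p) => [pl|pl].
  - rewrite (@KD_ge i i) ?leqnn // (@KD_ge i p) ?(ltnW kp) // (@KD_lt j i) ?ij //.
    have [pj|jp] := ltnP p j; last first.
      rewrite (@KD_ge j p) ?jp //.
      by case: b c {tu asym irr} => [] []; bool_lra.
    rewrite (@KD_lt j p) ?pj //.
    case: b c {tu irr} asym => [] [] asym; last 1 first.
    + have /comp1[h _] : (i < p < j)%N by rewrite kp pj.
      by case/negP: asym; exact: h.
    + have [||_ h] := comp2 p j i; first by rewrite pj.
        by rewrite kp.
      have e : lt (refl2 (pos i) (neg p)) (refl2 (pos i) (neg j)).
        by rewrite (refl2_negC (negbT kp1)) (refl2_negC (negbT ij1)).
      by case/negP: asym; exact: e.
    + have [||h _] := comp2 i p j; first by rewrite kp.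
        by rewrite pj orbT.
      by case/negP: asym; exact: h.
    by bool_lra.
  - rewrite (@KD_ge i i) ?leqnn // (@KD_last i p il pl) (@KD_lt j i) ?ij // (@KD_last j p jl pl).
    case: b {tu irr} asym => asym; last by case: c {asym} => /=; bool_lra.
    have [||h _] := comp3 i j p c c; first by rewrite ij.
      by rewrite pl.
    by case/negP: asym; exact: h.
  - rewrite (@KD_ge i i) ?leqnn // (@KD_ge i p) ?(ltnW kp) // (@KD_last i j il jl) (@KD_last p j pl jl).
    case: c {tu irr} asym => asym; first by case: b {asym} => /=; bool_lra.
    case: b asym => asym.
      have [||h _] := comp2 i p j; first by rewrite kp.
        by rewrite jl /= pl orbT.
      by case/negP: asym; exact: h.
    have /comp1[h _] : (i < p < j)%N by rewrite kp jl.
    by case/negP: asym; exact: h.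
  by rewrite jl pl eqxx in njp.
have [ejp|njp] := eqVneq j p.
  subst p; rewrite ij1 kp2; case: (lastP j) => [jl|jl].
    rewrite (@KD_ge i j) ?(ltnW ij) // (@KD_lt j k) ?kp // (@KD_ge j j) ?leqnn //.
    have [ki|ik] := ltnP k i; last first.
      by rewrite (@KD_ge i k) ?ik //; case: b c {tu asym irr} => [] []; bool_lra.
    rewrite (@KD_lt i k) ?ki //; case: b c {tu irr} asym => [] [] asym; try by bool_lra.
      have [||_ h] := comp2 k i j; first by rewrite ki.
        by rewrite ij orbT.
      by case/negP: asym; exact: h.
    have /comp1[_ h] : (k < i < j)%N by rewrite ki ij.
    by case/negP: asym; exact: h.
  rewrite (@KD_last i j il jl) (@KD_last k j kl jl) (@KD_last2 j jl).
  have [ki|ik] := ltnP k i; last first.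
    by rewrite (@KD_ge i k) ?ik //; case: b c {tu asym irr} => [] []; bool_lra.
  rewrite (@KD_lt i k) ?ki //; case: b c {tu irr} asym => [] [] asym; try by bool_lra.
    have [||_ h] := comp2 k i j; first by rewrite ki.
      by rewrite ij orbT.
    by case/negP: asym; exact: h.
  have /comp1[_ h] : (k < i < j)%N by rewrite ki ij.
  by case/negP: asym; exact: h.
have [eip|nip] := eqVneq i p.
  subst p; have kj := ltn_trans kp ij; have [_ ->] := ne _ _ kj.
  rewrite (@KD_lt i k) ?kp // (@KD_ge i i) ?leqnn //; case: (lastP j) => [jl|jl].
    rewrite (@KD_lt j k) ?kj // (@KD_lt j i) ?ij //.
    by case: b c {tu asym irr} => [] []; bool_lra.
  rewrite (@KD_last k j kl jl) (@KD_last i j il jl).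
  case: c {tu irr} asym => asym; last by case: b {asym} => /=; bool_lra.
  have [||_ h] := comp3 k i j b b; first by rewrite kp.
    by rewrite jl.
  by case/negP: asym; exact: h.
have [ejk|njk] := eqVneq j k; last by move=> _; bool_lra.
subst k; have ip := ltn_trans ij kp.
rewrite (@KD_ge i j) ?(ltnW ij) // (@KD_ge j j) ?leqnn //; case: (lastP p) => [pl|pl].
  rewrite (@KD_ge i p) ?(ltnW ip) // (@KD_ge j p) ?(ltnW kp) //.
  case: b c {tu irr} asym => [] [] asym; try by bool_lra.
  have [||h _] := comp2 j p i; first by rewrite kp.
    by rewrite ij.
  have e : lt (refl2 (pos j) (pos p)) (refl2 (pos i) (neg j)).
    by rewrite (refl2_negC (negbT ij1)).
  by case/negP: asym; exact: e.
rewrite (@KD_last i p il pl) (@KD_last j p kl pl).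
by case: b c {tu asym irr} => [] []; bool_lra.
Qed.

Theorem EL_labelingD lt : strict_total_order_on (TD n) lt -> compatibleD lt ->
  EL_labeling (TD n) lt (@natural_label _ (WD n) (TD n) (coxD n)).
Proof.
move=> tot comp; apply: (EL_labeling_of_root_data root_dataD tot).
exact: obtuseD.
Qed.

End TypeD.

Local Close Scope ring_scope.

Theorem corollary3p12 :
  (forall (n : nat) (lt : rel {perm 'I_n}),
     2 <= n -> strict_total_order_on (TA n) lt -> compatibleA lt ->
     EL_labeling (TA n) lt (@natural_label _ (WA n) (TA n) (coxA n)))
  /\ (forall (n : nat) (lt : rel {perm (letter n)}),
     2 <= n -> strict_total_order_on (TB n) lt -> compatibleB lt ->
     EL_labeling (TB n) lt (@natural_label _ (WB n) (TB n) (coxB n)))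
  /\ (forall (n : nat) (lt : rel {perm (letter n)}),
     4 <= n -> strict_total_order_on (TD n) lt -> compatibleD lt ->
     EL_labeling (TD n) lt (@natural_label _ (WD n) (TD n) (coxD n))).
Proof.
split; last split.
- by move=> n lt n_gt1; apply: EL_labelingA.
- by move=> n lt n_gt1; apply: EL_labelingB.
by move=> n lt n_gt3; apply: EL_labelingD; apply: ltnW.
Qed.
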